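(* Let $N\ge2$ and $A\in M_N(\{0,1\})$. (i) For every $J\in\{1,\ldots,N\}^{\#}_{A,c}$, a representation of ${\cal O}_A$ which is $P(J)$ exists and is unique up to unitary equivalence. (ii) For every $J\in\{1,\ldots,N\}^{*}_{A,c}$ and $z\in U(1)$, a representation of ${\cal O}_A$ which is $P(J;z)$ exists and is unique up to unitary equivalence.
   Context: ${\bf N}=\{1,2,\ldots\}$, $U(1)=\{z\in{\bf C}:|z|=1\}$. $M_N(\{0,1\})$ is the set of $N\times N$ matrices with entries in $\{0,1\}$ having no row or column identically equal to zero. For $A=(a_{ij})\in M_N(\{0,1\})$, the Cuntz-Krieger algebra ${\cal O}_A$ is the $C^*$-algebra universally generated by partial isometries $s_1,\ldots,s_N$ satisfying $s_i^*s_i=\sum_{j=1}^N a_{ij}s_js_j^*$ for $i=1,\ldots,N$ and $\sum_{i=1}^N s_is_i^*=I$. A representation is a unital $*$-representation on a complex Hilbert space. $\{1,\ldots,N\}^k_{A,c}$ ($k\ge1$) is the set of $(j_1,\ldots,j_k)\in\{1,\ldots,N\}^k$ with $a_{j_{i-1}j_i}=1$ for $i=2,\ldots,k$ and $a_{j_kj_1}=1$; $\{1,\ldots,N\}^*_{A,c}=\coprod_{k\ge1}\{1,\ldots,N\}^k_{A,c}$. $\{1,\ldots,N\}^\infty_A$ is the set of sequences $(j_n)_{n\in{\bf N}}$ in $\{1,\ldots,N\}$ with $a_{j_{n-1}j_n}=1$ for all $n\ge2$. $\{1,\ldots,N\}^{\#}_{A,c}=\{1,\ldots,N\}^*_{A,c}\sqcup\{1,\ldots,N\}^\infty_A$.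 For $J=(j_l)_{l=1}^p$ finite and $z\in U(1)$, a representation $({\cal H},\pi)$ of ${\cal O}_A$ is $P(J;z)$ if there is a cyclic unit vector $\Omega\in{\cal H}$ such that $\pi(s_{j_1}\cdots s_{j_p})\Omega=z\Omega$ and $\{\pi(s_{j_l}\cdots s_{j_p})\Omega\}_{l=1}^p$ is an orthonormal family; it is $P(J)$ if it is $P(J;1)$. For $J=(j_n)_{n\in{\bf N}}$ infinite, $({\cal H},\pi)$ is $P(J)$ if there is a cyclic unit vector $\Omega\in{\cal H}$ such that $\{\pi(s_{j_n}^*\cdots s_{j_1}^* )\Omega\}_{n\in{\bf N}}$ is an orthonormal family. *)

(* Defs.v *)
From HB Require Import structures.
From mathcomp Require Import all_boot all_order all_algebra.
From mathcomp Require Import complex.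
From mathcomp Require Import all_classical all_reals all_analysis.

Set Implicit Arguments.
Unset Strict Implicit.
Unset Printing Implicit Defensive.
Import Order.TTheory GRing.Theory Num.Theory.
Import numFieldNormedType.Exports.
Local Open Scope classical_set_scope.
Local Open Scope complex_scope.
Local Open Scope ring_scope.

(* The norm is a real-valued field of its own: in the library's hierarchy the
   only common extension of rings and normed Z-modules is numDomainType, so a
   type cannot be made both an algType and a normedModType. Library algebras
   are non-trivial, so 1 != 0 in every C*-algebra below. *)
HB.mixin Record isCStarAlgebra (R : realType) A & GRing.Algebra R[i] A := {
  cnorm : A -> R ;
  cnorm_eq0 : forall a, cnorm a = 0 -> a = 0 ;
  ler_cnormD : forall a b, cnorm (a + b) <= cnorm a + cnorm b ;
  cnormZ : forall (c : R[i]) a, (cnorm (c *: a))%:C = `|c| * (cnorm a)%:C ;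
  ler_cnormM : forall a b, cnorm (a * b) <= cnorm a * cnorm b ;
  cnorm_complete : forall u : nat -> A,
    (forall e : R, 0 < e -> exists n0 : nat, forall m n : nat,
       (n0 <= m)%N -> (n0 <= n)%N -> cnorm (u m - u n) < e) ->
    exists l, (fun n => cnorm (u n - l)) @ \oo --> (0 : R) ;
  star : A -> A ;
  starK : involutive star ;
  starD : forall a b, star (a + b) = star a + star b ;
  starZ : forall (c : R[i]) a, star (c *: a) = Num.conj c *: star a ;
  starM : forall a b, star (a * b) = star b * star a ;
  cnorm_star : forall a, cnorm (star a * a) = cnorm a ^+ 2 }.

#[short(type="cstarAlgType")]
HB.structure Definition CStarAlgebra (R : realType) :=
  {A of GRing.Algebra R[i] A & isCStarAlgebra R A}.

(* The inner product is linear in its first argument. *)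
HB.mixin Record isHilbert (R : realType) H & CompleteNormedModule R[i] H := {
  inner : {dot H for (@Num.conj R[i])} ;
  inner_norm : forall x : H, `|x| ^+ 2 = inner x x }.

#[short(type="hilbertType")]
HB.structure Definition Hilbert (R : realType) :=
  {H of CompleteNormedModule R[i] H & isHilbert R H}.

Record cstar_subalgebra (R : realType) (B : cstarAlgType R) (S : set B) : Prop :=
  CStarSubalgebra {
    cstar_sub_closed : forall (u : nat -> B) (l : B), (forall n, S (u n)) ->
      (fun n => cnorm (u n - l)) @ \oo --> (0 : R) -> S l ;
    cstar_sub1 : S 1 ;
    cstar_subD : forall a b, S a -> S b -> S (a + b) ;
    cstar_subZ : forall (c : R[i]) a, S a -> S (c *: a) ;
    cstar_subM : forall a b, S a -> S b -> S (a * b) ;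
    cstar_sub_star : forall a, S a -> S (star a) }.

Record cuntz_krieger_family (R : realType) (N : nat) (A : 'M[bool]_N)
    (B : cstarAlgType R) (s : 'I_N -> B) : Prop := CuntzKriegerFamily {
  ck_partial_isometry : forall i, s i * star (s i) * s i = s i ;
  ck_initial : forall i,
    star (s i) * s i = \sum_(j < N) (A i j)%:R *: (s j * star (s j)) ;
  ck_sum : \sum_(i < N) s i * star (s i) = 1 }.

(* (B, s) is the Cuntz-Krieger algebra O_A with its canonical generators; this
   determines (B, s) up to isomorphism. The morphism f below is unique because
   the s i generate B. *)
Record is_cuntz_krieger_algebra (R : realType) (N : nat) (A : 'M[bool]_N)
    (B : cstarAlgType R) (s : 'I_N -> B) : Prop := IsCuntzKriegerAlgebra {
  ck_family : cuntz_krieger_family A s ;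
  ck_generated : forall S : set B,
    cstar_subalgebra S -> (forall i, S (s i)) -> S = setT ;
  ck_universal : forall (D : cstarAlgType R) (t : 'I_N -> D),
    cuntz_krieger_family A t ->
    exists f : {lrmorphism B -> D},
      (forall a, f (star a) = star (f a)) /\ (forall i, f (s i) = t i) }.

Definition no_zero_row_col (N : nat) (A : 'M[bool]_N) : Prop :=
  (forall i, exists j, A i j) /\ (forall j, exists i, A i j).

(* Unital *-homomorphisms from B to the bounded operators on H. *)
Record representation (R : realType) (B : cstarAlgType R) (H : hilbertType R) :=
  Representation {
    rep_op :> B -> {linear H -> H} ;
    rep_bounded : forall a, exists M : R[i], forall x, `|rep_op a x| <= M * `|x| ;
    repD : forall a b x, rep_op (a + b) x = rep_op a x + rep_op b x ;
    repZ : forall (c : R[i]) a x, rep_op (c *: a) x = c *: rep_op a x ;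
    repM : forall a b x, rep_op (a * b) x = rep_op a (rep_op b x) ;
    rep1 : forall x, rep_op 1 x = x ;
    rep_star : forall a x y,
      inner (rep_op a x) y = inner x (rep_op (star a) y) }.

Definition cyclic_vector (R : realType) (B : cstarAlgType R) (H : hilbertType R)
    (pi : representation B H) (Omega : H) : Prop :=
  dense (range (fun a => pi a Omega)).

Definition orthonormal_family (R : realType) (H : hilbertType R) (I : eqType)
    (v : I -> H) : Prop :=
  forall k l : I, inner (v k) (v l) = (k == l)%:R.

Definition unitarily_equivalent (R : realType) (B : cstarAlgType R)
    (H1 H2 : hilbertType R) (pi1 : representation B H1)
    (pi2 : representation B H2) : Prop :=
  exists U : {linear H1 -> H2},
    [/\ (forall y, exists x, U x = y),
        (forall x y, inner (U x) (U y) = inner x y) &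
        (forall a x, U (pi1 a x) = pi2 a (U x))].

(* Members of {1..N}^*_{A,c}: for J = [:: j_1; ...; j_p], [cycle] includes the
   closing condition a_{j_p j_1} = 1, and for p = 1 it reads a_{j_1 j_1} = 1. *)
Definition cyclic_word (N : nat) (A : 'M[bool]_N) (J : seq 'I_N) : bool :=
  (J != [::]) && cycle (fun i j => A i j) J.

(* Sequences are indexed from 0: J n is j_{n+1}. *)
Definition infinite_word (N : nat) (A : 'M[bool]_N) (J : nat -> 'I_N) : Prop :=
  forall n, A (J n) (J n.+1).

Definition sharp_word (N : nat) (A : 'M[bool]_N)
    (J : seq 'I_N + (nat -> 'I_N)) : Prop :=
  match J with
  | inl J => cyclic_word A J
  | inr J => infinite_word A J
  end.

(* P(J;z) for finite J. *)
Definition is_Pz (R : realType) (N : nat) (B : cstarAlgType R) (s : 'I_N -> B)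
    (J : seq 'I_N) (z : R[i]) (H : hilbertType R) (pi : representation B H)
    : Prop :=
  exists Omega : H,
    [/\ `|Omega| = 1,
        cyclic_vector pi Omega,
        pi (\prod_(j <- J) s j) Omega = z *: Omega &
        orthonormal_family
          (fun l : 'I_(size J) => pi (\prod_(j <- drop l J) s j) Omega)].

(* P(J) for infinite J; the n-th vector, n = 0, 1, ..., is
   pi(s_{j_{n+1}}^* ... s_{j_1}^* ) Omega. *)
Definition is_P_infinite (R : realType) (N : nat) (B : cstarAlgType R)
    (s : 'I_N -> B) (J : nat -> 'I_N) (H : hilbertType R)
    (pi : representation B H) : Prop :=
  exists Omega : H,
    [/\ `|Omega| = 1,
        cyclic_vector pi Omega &
        orthonormal_family
          (fun n : nat =>
             pi (\prod_(j <- rev (mkseq J n.+1)) star (s j)) Omega)].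

Definition is_P (R : realType) (N : nat) (B : cstarAlgType R) (s : 'I_N -> B)
    (J : seq 'I_N + (nat -> 'I_N)) (H : hilbertType R)
    (pi : representation B H) : Prop :=
  match J with
  | inl J => is_Pz s J 1 pi
  | inr J => is_P_infinite s J pi
  end.

Definition exists_unique_rep (R : realType) (B : cstarAlgType R)
    (P : forall H : hilbertType R, representation B H -> Prop) : Prop :=
  (exists (H : hilbertType R) (pi : representation B H), P H pi) /\
  (forall (H1 H2 : hilbertType R) (pi1 : representation B H1)
      (pi2 : representation B H2),
    P H1 pi1 -> P H2 pi2 -> unitarily_equivalent pi1 pi2).

(* Main.v *)
Require Import Defs.
From HB Require Import structures.
From mathcomp Require Import all_boot all_order all_algebra.
From mathcomp Require Import complex.
From mathcomp Require Import all_classical all_reals all_analysis.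
From mathcomp Require Import ring lra.

(** A closed word of length [p] with scalar [z] and an infinite word are treated
    alike. Repeating the closed word gives an infinite word [J], and with a
    [p]-th root [zeta] of [z] both kinds of representations are those with a
    cyclic vector [v 0] and vectors [v n] such that
    [pi (s (J n)) (v n.+1) = zeta *: v n], where [v n] and [v m] are equal unit
    vectors or orthogonal according to whether [n = m] modulo [p], with [p = 0]
    for a genuinely infinite word ([word_vectors]). The translations are
    [is_Pz_word_vectors], [is_P_infinite_word_vectors] and their converses.

    Uniqueness ([word_vectors_unique]). Applying generators to the [v n] gives
    path vectors [s_I v_n]. A generator prepends a letter to a path, and the
    adjoint of a generator removes one, up to a scalar that only depends on the
    combinatorial data ([path_vector_star]). Hence all inner products between
    path vectors are determined ([path_gram]), and path vectors with the same
    label in two representations correspond under a linear isometry of their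
    spans, which commutes with the generators and their adjoints. The elements
    of the algebra that preserve the closed graph of this isometry form a
    C*-subalgebra, hence are all elements; as the vectors [v 0] are cyclic, the
    closed graph is that of a unitary intertwiner ([equivalent_of_relation]).
    That this set of elements is closed needs representations to be continuous
    in norm ([rep_le]), which follows from the existence of square roots of
    [1 - h] for small self-adjoint [h] ([cstar_sqrt]).

    Existence ([word_vectors_exist]). Let [X] be the set of admissible sequences
    that eventually agree with [J] up to a displacement, together with that
    displacement modulo [p]. On the Hilbert space of square-summable families
    on [X], prepending the letter [i] and multiplying by [zeta] defines
    operators that satisfy the Cuntz-Krieger relations ([shift_ck_family]).
    Bounded operators with an adjoint form a C*-algebra [bop], and its universal
    property makes O_A act ([branching_rep]); the vectors [v n] are the basis
    vectors at the successive tails of [J]. *)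

Set Implicit Arguments.
Unset Strict Implicit.
Unset Printing Implicit Defensive.
Import Order.TTheory GRing.Theory Num.Theory.
Import numFieldNormedType.Exports.
Local Open Scope classical_set_scope.
Local Open Scope complex_scope.
Local Open Scope ring_scope.

(** * Positive definite sesquilinear forms *)

Section DotForms.
Variables (C : numClosedFieldType) (U : lmodType C) (form : {dot U for @Num.conj C}).
Local Notation "'[ u , v ]" := (form u v).

Lemma dotDl x y z : '[x + y, z] = '[x, z] + '[y, z].
Proof. exact: linearDl. Qed.
Lemma dotZl a x z : '[a *: x, z] = a * '[x, z].
Proof. by rewrite linearZl_LR. Qed.
Lemma dotC x y : '[x, y] = Num.conj '[y, x].
Proof. by rewrite hermC mul1r. Qed.
Lemma dotDr x y z : '[z, x + y] = '[z, x] + '[z, y].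
Proof. exact: linearDr. Qed.
Lemma dotZr a x z : '[z, a *: x] = Num.conj a * '[z, x].
Proof. by rewrite linearZr_LR. Qed.
Lemma dotNl x z : '[- x, z] = - '[x, z].
Proof. by rewrite -scaleN1r dotZl mulN1r. Qed.
Lemma dotNr x z : '[z, - x] = - '[z, x].
Proof. by rewrite dotC dotNl rmorphN /= -dotC. Qed.
Lemma dotBl x y z : '[x - y, z] = '[x, z] - '[y, z].
Proof. by rewrite dotDl dotNl. Qed.
Lemma dotBr x y z : '[z, x - y] = '[z, x] - '[z, y].
Proof. by rewrite dotDr dotNr. Qed.
Lemma dot0l z : '[0, z] = 0.
Proof. by rewrite -(scale0r 0) dotZl mul0r. Qed.
Lemma dot0r z : '[z, 0] = 0.
Proof. by rewrite dotC dot0l rmorph0. Qed.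
Lemma dot_suml (I : Type) (r : seq I) (F : I -> U) z :
  '[\sum_(i <- r) F i, z] = \sum_(i <- r) '[F i, z].
Proof. by elim/big_rec2: _ => [|i a b _ <-]; rewrite ?dot0l ?dotDl. Qed.
Lemma dot_sumr (I : Type) (r : seq I) (F : I -> U) z :
  '[z, \sum_(i <- r) F i] = \sum_(i <- r) '[z, F i].
Proof. by elim/big_rec2: _ => [|i a b _ <-]; rewrite ?dot0r ?dotDr. Qed.

Lemma cauchy_schwarz x y : `|'[x, y]| ^+ 2 <= '[x, x] * '[y, y].
Proof.
have [->|y0] := eqVneq y 0; first by rewrite !dot0r normr0 expr0n mulr0.
have yy : 0 < '[y, y] by rewrite dnorm_gt0.
have yyr : Num.conj '[y, y] = '[y, y] by rewrite -dotC.
have := dnorm_ge0 form ('[y, y] *: x - '[x, y] *: y).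
rewrite dotBl !dotBr !dotZl !dotZr yyr (dotC y x) normCK.
set a := '[y, y] in yy *; set b := '[x, y]; set b' := Num.conj b.
rewrite (_ : _ - _ = a * ('[x, x] * a - b * b')); last by ring.
by rewrite pmulr_rge0 // subr_ge0.
Qed.

Lemma cauchy_schwarz_sqrt x y : `|'[x, y]| <= sqrtC '[x, x] * sqrtC '[y, y].
Proof.
rewrite -(@ler_pXn2r _ 2) ?nnegrE ?mulr_ge0 ?sqrt_dnorm_ge0 //.
by rewrite exprMn !sqrtCK cauchy_schwarz.
Qed.

Lemma triangle_inequality x y :
  sqrtC '[x + y, x + y] <= sqrtC '[x, x] + sqrtC '[y, y].
Proof.
rewrite -(@ler_pXn2r _ 2) ?nnegrE ?addr_ge0 ?sqrt_dnorm_ge0 //.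
rewrite sqrrD !sqrtCK dotDl !dotDr (dotC y x).
set d := '[x, y]; set a := '[x, x]; set b := '[y, y].
rewrite (_ : _ + _ = a + b + (d + Num.conj d)); last by ring.
rewrite (_ : _ + _ + b = a + b + sqrtC a * sqrtC b *+ 2); last by ring.
rewrite lerD2l.
have dr : d + Num.conj d \is Num.real.
  by apply/CrealP; rewrite rmorphD /= conjCK addrC.
apply: le_trans (real_ler_norm dr) _.
apply: le_trans (ler_normD _ _) _.
by rewrite norm_conjC -mulr2n ler_pMn2r // cauchy_schwarz_sqrt.
Qed.

Lemma polarization x y :
  '[x, y] *+ 4 = ('[x + y, x + y] - '[x - y, x - y])
   + 'i * ('[x + 'i *: y, x + 'i *: y] - '[x - 'i *: y, x - 'i *: y]).
Proof.
rewrite !dotDl !dotDr !dotNl !dotNr !dotZl !dotZr conjCi.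
set a := '[x, y]; set b := '[y, x].
transitivity ((a + b) *+ 2 - 'i ^+ 2 * (a - b) *+ 2); last by ring.
by rewrite sqrCi; ring.
Qed.
End DotForms.

(** * Square roots in a C*-algebra *)

Section CStar.
Variables (R : realType) (B : cstarAlgType R).
Implicit Types (a b h : B).

Lemma cnorm0 : cnorm (0 : B) = 0.
Proof.
apply/(@complexI R); have := cnormZ (0 : R[i]) (0 : B).
by rewrite scale0r normr0 mul0r => ->.
Qed.

Lemma cnormN a : cnorm (- a) = cnorm a.
Proof. by apply/(@complexI R); rewrite -scaleN1r cnormZ normrN normr1 mul1r. Qed.

Lemma cnorm_ge0 a : 0 <= cnorm a.
Proof.
have := ler_cnormD a (- a); rewrite subrr cnorm0 cnormN.
by move=> ?; lra.
Qed.

Lemma cnormBC a b : cnorm (a - b) = cnorm (b - a).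
Proof. by rewrite -cnormN opprB. Qed.

Lemma cnormZr (t : R) a : 0 <= t -> cnorm (t%:C *: a) = t * cnorm a.
Proof.
move=> t0; apply/(@complexI R); rewrite cnormZ ger0_norm ?ler0c //.
by rewrite -rmorphM.
Qed.

Lemma star0 : star (0 : B) = 0.
Proof. by have := starZ 0 (0 : B); rewrite !scale0r rmorph0 scale0r. Qed.

Lemma starN a : star (- a) = - star a.
Proof. by rewrite -scaleN1r starZ rmorphN rmorph1 scaleN1r. Qed.

Lemma starB a b : star (a - b) = star a - star b.
Proof. by rewrite starD starN. Qed.

Lemma star1 : star (1 : B) = 1.
Proof.
have := starM (star 1 : B) 1; rewrite mulr1 starK => e.
by rewrite -[LHS]mulr1 -e.
Qed.

(** The C*-identity and submultiplicativity give [|a|^2 <= |star a| |a|]. *)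
Lemma cnorm_starE a : cnorm (star a) = cnorm a.
Proof.
suff le b : cnorm b <= cnorm (star b).
  by apply/eqP; rewrite eq_le le andbT -{2}(starK a) le.
have [b0|b0] := eqVneq (cnorm b) 0; first by rewrite b0 cnorm_ge0.
have bp : 0 < cnorm b by rewrite lt_def b0 cnorm_ge0.
rewrite -(ler_pM2r bp) -expr2 -cnorm_star; exact: ler_cnormM.
Qed.

Lemma cnorm_cvgP (u : nat -> B) l :
  (fun n => cnorm (u n - l)) @ \oo --> (0 : R) ->
  forall e : R, 0 < e -> exists n0, forall n, (n0 <= n)%N -> cnorm (u n - l) < e.
Proof.
move=> /cvgrPdist_lt cv e e0; have [n0 _ h] := cv e e0; exists n0 => n n0n.
by have := h n n0n; rewrite /= sub0r normrN ger0_norm ?cnorm_ge0.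
Qed.

Lemma cnorm_small0 a : (forall e : R, 0 < e -> cnorm a <= e) -> a = 0.
Proof.
move=> h; apply/cnorm_eq0/eqP; rewrite eq_le cnorm_ge0 andbT.
by apply/ler_addgt0Pl => e e0; rewrite addr0 h.
Qed.

(** The iteration [y |-> (h + y^2) / 2] maps the ball of radius 1/2 to itself
    and halves distances there; its fixed point [y] has [(1 - y)^2 = 1 - h]. *)
Fixpoint sqrt_iter h n : B :=
  if n is m.+1 then (1/2)%:C *: (h + sqrt_iter h m * sqrt_iter h m) else 0.

Lemma sqrt_iter_le h n : cnorm h <= 1/2 -> cnorm (sqrt_iter h n) <= 1/2.
Proof.
move=> hh; elim: n => [|n IH] /=; first by rewrite cnorm0.
rewrite cnormZr //.
have := ler_cnormD h (sqrt_iter h n * sqrt_iter h n).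
have := ler_cnormM (sqrt_iter h n) (sqrt_iter h n).
have := cnorm_ge0 (sqrt_iter h n).
by nra.
Qed.

Lemma sqrt_iter_sa h n : star h = h -> star (sqrt_iter h n) = sqrt_iter h n.
Proof.
move=> hh; elim: n => [|n IH] /=; first exact: star0.
rewrite starZ starD starM IH hh conj_Creal //.
by apply/complex_realP; exists (1/2).
Qed.

Lemma cnorm_sqrB (y z : B) :
  cnorm (y * y - z * z) <= (cnorm y + cnorm z) * cnorm (y - z).
Proof.
rewrite (_ : _ - _ = y * (y - z) + (y - z) * z); last first.
  by rewrite mulrBr mulrBl addrA subrK.
have := ler_cnormD (y * (y - z)) ((y - z) * z).
have := ler_cnormM y (y - z); have := ler_cnormM (y - z) z.
by nra.
Qed.

(** Comparing the [n]-th iterate with the [(n + k)]-th at once dispenses with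
    summing a geometric series. *)
Lemma sqrt_iter_cauchy h n k : cnorm h <= 1/2 ->
  cnorm (sqrt_iter h (n + k) - sqrt_iter h n) <= (1/2) ^+ n.
Proof.
move=> hh; elim: n => [|n IH].
  by rewrite expr0 subr0; apply: le_trans (sqrt_iter_le _ hh) _; lra.
rewrite addSn /= -scalerBr opprD addrACA subrr add0r cnormZr // exprS.
have := cnorm_sqrB (sqrt_iter h (n + k)) (sqrt_iter h n).
have := sqrt_iter_le (n + k) hh; have := sqrt_iter_le n hh.
have := cnorm_ge0 (sqrt_iter h (n + k) - sqrt_iter h n).
by nra.
Qed.

Lemma cstar_sqrt h : star h = h -> cnorm h <= 1/2 ->
  exists2 y, star y = y & (1 - y) * (1 - y) = 1 - h.
Proof.
move=> sh hh; pose u := sqrt_iter h.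
have u_cauchy (e : R) : 0 < e -> exists n0 : nat, forall m n : nat,
       (n0 <= m)%N -> (n0 <= n)%N -> cnorm (u m - u n) < e.
  move=> e0; have [n0 hn0] : exists n0, 2 * (1/2 : R) ^+ n0 < e.
    have /cvgrPdist_lt/(_ (e / 2)) : (fun n => (1/2 : R) ^+ n) @ \oo --> (0 : R).
      by apply: cvg_expr; rewrite ger0_norm; lra.
    case; first by lra.
    move=> n0 _ /(_ n0 (leqnn _)) /=; rewrite sub0r normrN ger0_norm ?exprn_ge0//.
    by exists n0; lra.
  exists n0 => m n nm nn.
  have -> : u m - u n = (u m - u n0) + (u n0 - u n) by rewrite addrA subrK.
  apply: le_lt_trans (ler_cnormD _ _) _; rewrite (cnormBC (u n0)).
  have := sqrt_iter_cauchy n0 (m - n0) hh; rewrite subnKC // -/(u _) -/(u _).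
  have := sqrt_iter_cauchy n0 (n - n0) hh; rewrite subnKC // -/(u _) -/(u _).
  by lra.
have [l /cnorm_cvgP ul] := cnorm_complete u u_cauchy.
have lsa : star l = l.
  apply/subr0_eq/cnorm_small0 => e e0.
  have [n /(_ n (leqnn n)) hn] := ul (e / 2) ltac:(lra).
  have -> : star l - l = star (l - u n) + (u n - l).
    by rewrite starB (sqrt_iter_sa _ sh) addrA subrK.
  apply: le_trans (ler_cnormD _ _) _; rewrite cnorm_starE (cnormBC l).
  by lra.
have lfix : l = (1/2)%:C *: (h + l * l).
  apply/subr0_eq/cnorm_small0 => e e0.
  have K0 := cnorm_ge0 l; set K := cnorm l in K0.
  have e1 : 0 < e / (2 + K) by rewrite divr_gt0 //; lra.
  have [n hn] := ul _ e1.
  have hn1 := hn n (leqnn n); have hn2 := hn n.+1 (leqnSn n).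
  have -> : l - (1/2)%:C *: (h + l * l) =
    (l - u n.+1) + (1/2)%:C *: (u n * u n - l * l).
    rewrite [u n.+1]/= -/(u n).
    have -> : u n * u n - l * l = (h + u n * u n) - (h + l * l).
      by rewrite opprD addrACA subrr add0r.
    by rewrite scalerBr addrA subrK.
  apply: le_trans (ler_cnormD _ _) _; rewrite cnormZr // (cnormBC l).
  have := cnorm_sqrB (u n) l; have := sqrt_iter_le n hh; rewrite -/(u n) -/K.
  have := cnorm_ge0 (u n - l); set d := cnorm (u n - l) in hn1 *.
  move: (cnorm (_ - _ * _)) => D d0 un hD.
  have K2 : 2 + K != 0 by rewrite gt_eqF //; lra.
  have : e = (2 + K) * (e / (2 + K)) by rewrite mulrC divfK.
  by set t := e / _ in hn1 hn2 e1 *; nra.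
exists l => //.
have e2 : l + l = h + l * l.
  rewrite {1 2}lfix -scalerDl -rmorphD /=.
  by rewrite (_ : 1/2 + 1/2 = 1) ?scale1r //; lra.
rewrite mulrBl mul1r mulrBr mulr1 opprB addrA addrAC -[1 - l - l]addrA -opprD e2.
by rewrite opprD addrA subrK.
Qed.
End CStar.

(** * Norms with values in the reals *)

Lemma ltr0c (R : rcfType) (k : R) : (0 < k%:C) = (0 < k).
Proof. by rewrite -[0 in LHS]/(0%:C) ltcR. Qed.

Section RealNorm.
Variables (R : realType) (V : normedModType R[i]).
Implicit Types x y : V.

(** Norms over [R[i]] are complex numbers, for which the order is partial;
    their real parts live in an ordered field, where linear arithmetic applies. *)
Definition rnorm x : R := complex.Re `|x|.

Lemma rnormE x : (rnorm x)%:C = `|x|.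
Proof. by rewrite /rnorm RRe_real // ger0_real. Qed.

Lemma rnorm_ge0 x : 0 <= rnorm x.
Proof. by rewrite -ler0c rnormE. Qed.

Lemma ler_rnormD x y : rnorm (x + y) <= rnorm x + rnorm y.
Proof. by rewrite -lecR rmorphD /= !rnormE ler_normD. Qed.

Lemma rnormBC x y : rnorm (x - y) = rnorm (y - x).
Proof. by rewrite /rnorm distrC. Qed.

Lemma rnorm0 : rnorm 0 = 0.
Proof. by rewrite /rnorm normr0. Qed.

Lemma rnorm_eq0 x : rnorm x = 0 -> x = 0.
Proof. by move=> h; apply/normr0_eq0; rewrite -rnormE h. Qed.

Lemma rnormZ (c : R[i]) x : rnorm (c *: x) = complex.Re `|c| * rnorm x.
Proof.
apply/(@complexI R); rewrite rmorphM [LHS]rnormE normrZ -[`|x|]rnormE.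
by congr (_ * _); rewrite RRe_real ?ger0_real.
Qed.

Lemma rnormZr (t : R) x : 0 <= t -> rnorm (t%:C *: x) = t * rnorm x.
Proof. by move=> t0; rewrite rnormZ ger0_norm ?ler0c. Qed.

Lemma ler_rnormB3 x y z : rnorm (x - z) <= rnorm (x - y) + rnorm (y - z).
Proof. by rewrite -lecR rmorphD /= !rnormE ler_distD. Qed.

Lemma dense_rnorm (D : set V) x (e : R) : dense D -> 0 < e ->
  exists2 a, D a & rnorm (x - a) < e.
Proof.
move=> dD e0; have [] := dD (ball x e%:C).
- by exists x; apply: ballxx; rewrite ltr0c.
- exact: ball_open.
- move=> a [+ Da]; rewrite -ball_normE /= => h; exists a => //.
  by rewrite -ltcR rnormE.
Qed.

Lemma rnorm_dense (D : set V) :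
  (forall x (e : R), 0 < e -> exists2 a, D a & rnorm (x - a) < e) -> dense D.
Proof.
move=> h O [x Ox] oO.
have /nbhs_ballP [e /= e0 eO] : nbhs x O by apply: open_nbhs_nbhs; split.
have er : e = (complex.Re e)%:C by rewrite RRe_real // gtr0_real.
have [|a Da] := h x (complex.Re e); first by rewrite -ltr0c -er.
rewrite -ltcR rnormE -er => xa; exists a; split => //; apply: eO.
by rewrite -ball_normE.
Qed.
End RealNorm.

Lemma rnorm_complete (R : realType) (V : completeNormedModType R[i]) (u : nat -> V) :
  (forall e : R, 0 < e -> exists n0 : nat, forall m n : nat,
     (n0 <= m)%N -> (n0 <= n)%N -> rnorm (u m - u n) < e) ->
  exists l, forall e : R, 0 < e ->
    exists n0, forall n, (n0 <= n)%N -> rnorm (u n - l) < e.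
Proof.
move=> uc.
have /cauchy_cvgP /cvg_ex [l /cvgrPdist_lt cl] : cauchy (u @ \oo).
  apply/cauchy_ballP => e e0; have er : e = (complex.Re e)%:C.
    by rewrite RRe_real // gtr0_real.
  have [|n0 h] := uc (complex.Re e); first by rewrite -ltr0c -er.
  exists (u @` [set k | (n0 <= k)%N], u @` [set k | (n0 <= k)%N]).
    by split; exists n0 => // k /= hk; exists k.
  move=> [_ _] [[m /= hm <-] [n /= hn <-]].
  by rewrite -ball_normE /= -rnormE er ltcR; exact: h.
exists l => e e0; have [|n0 _ h] := cl e%:C; first by rewrite ltr0c.
exists n0 => n n0n; rewrite rnormBC -ltcR rnormE; exact: h.
Qed.

Section HilbertNorm.
Variables (R : realType) (H : hilbertType R).
Implicit Types x y : H.

Lemma inner_rnorm x : inner x x = ((rnorm x) ^+ 2)%:C.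
Proof. by rewrite rmorphXn /= rnormE inner_norm. Qed.

Lemma inner_le_rnorm x y : `|inner x y| <= (rnorm x * rnorm y)%:C.
Proof.
apply: le_trans (cauchy_schwarz_sqrt _ _ _) _.
by rewrite -!inner_norm !sqrCK // -!rnormE -rmorphM.
Qed.
End HilbertNorm.

Lemma rnorm_inner_eq (R : realType) (H K : hilbertType R) (x : H) (y : K) :
  inner x x = inner y y -> rnorm x = rnorm y.
Proof.
rewrite !inner_rnorm => e; have {}e := @complexI R _ _ e.
by apply/eqP; rewrite -(@eqrXn2 _ 2) ?rnorm_ge0 // e.
Qed.

(** * Representations of C*-algebras are continuous *)

Section RepBound.
Variables (R : realType) (B : cstarAlgType R) (H : hilbertType R).
Variable pi : representation B H.

Lemma rep_star2 a x : inner (pi a x) (pi a x) = inner (pi (star a * a) x) x.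
Proof. by rewrite repM -{2}(starK a) -{1}[a]starK -rep_star !starK. Qed.

Lemma repB a b x : pi (a - b) x = pi a x - pi b x.
Proof. by rewrite repD -scaleN1r repZ scaleN1r. Qed.

Lemma rep0 x : pi 0 x = 0.
Proof. by have := repB 0 0 x; rewrite !subrr. Qed.

Lemma rep_sum (I : Type) (r : seq I) (F : I -> B) x :
  pi (\sum_(i <- r) F i) x = \sum_(i <- r) pi (F i) x.
Proof. by elim/big_rec2: _ => [|i a b _ <-]; rewrite ?rep0 ?repD. Qed.

(** If [h = star a * a] is small then [1 - h] is the square of a self-adjoint
    element, so that [<x, x> - <pi h x, x>] is a squared length. *)
Lemma rep_half_contraction a x : cnorm a <= 1/2 -> rnorm (pi a x) <= rnorm x.
Proof.
move=> a2; have hsa : star (star a * a) = star a * a by rewrite starM starK.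
have hle : cnorm (star a * a) <= 1/2.
  by rewrite cnorm_star; have := cnorm_ge0 a; nra.
have [y ysa yE] := cstar_sqrt hsa hle.
have := dnorm_ge0 (@inner R H) (pi (1 - y) x).
rewrite rep_star2 starB star1 ysa yE repB rep1 dotBl -rep_star2.
rewrite !inner_rnorm subr_ge0 lecR ler_pXn2r // nnegrE; exact: rnorm_ge0.
Qed.

(** The individual bounds in the definition of a representation become one that
    is proportional to the norm of [a], by scaling [a] to norm 1/2; the limit of
    [pi (u n) x] is then [pi l x] when [u] tends to [l]. *)
Lemma rep_le a x : rnorm (pi a x) <= 2 * cnorm a * rnorm x.
Proof.
have [a0|a0] := eqVneq (cnorm a) 0.
  by rewrite (cnorm_eq0 _ a0) rep0 rnorm0 cnorm0 mulr0 mul0r.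
have ap : 0 < cnorm a by rewrite lt_def a0 cnorm_ge0.
have t0 : 0 <= (2 * cnorm a)^-1 by rewrite invr_ge0; lra.
have a2 : cnorm ((2 * cnorm a)^-1%:C *: a) <= 1/2.
  by rewrite cnormZr // invfM -mulrA mulVf // mulr1; lra.
have := rep_half_contraction x a2; rewrite repZ rnormZr // ler_pdivrMl //.
by lra.
Qed.
End RepBound.

(** * Unitary maps from isometric relations *)

Section IsometricRelation.
Variables (R : realType) (H1 H2 : hilbertType R).
Variable G : H1 -> H2 -> Prop.

(** A partially defined linear isometry is handled through its graph [G], a
    relation: no choice of representatives is needed to define it on a span,
    and its continuous extension is the closure of the graph. *)
Definition rel_closure x y := forall e : R, 0 < e ->
  exists a b, [/\ G a b, rnorm (x - a) < e & rnorm (y - b) < e].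

Hypothesis G_lin : forall (c : R[i]) a b a' b',
  G a b -> G a' b' -> G (c *: a + a') (c *: b + b').
Hypothesis G_iso : forall a b, G a b -> rnorm a = rnorm b.

Lemma sub_rel_closure a b : G a b -> rel_closure a b.
Proof. by move=> Gab e e0; exists a, b; rewrite !subrr !rnorm0. Qed.

Lemma rel_closureK x y :
  (forall e : R, 0 < e ->
     exists a b, [/\ rel_closure a b, rnorm (x - a) < e & rnorm (y - b) < e]) ->
  rel_closure x y.
Proof.
move=> h e e0; have e2 : 0 < e / 2 by lra.
have [a [b [cab xa yb]]] := h _ e2.
have [a' [b' [Gab aa' bb']]] := cab _ e2; exists a', b'; split => //.
- have := ler_rnormB3 x a a'; lra.
- have := ler_rnormB3 y b b'; lra.
Qed.

Lemma rel_closure_lin (c : R[i]) x y x' y' :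
  rel_closure x y -> rel_closure x' y' ->
  rel_closure (c *: x + x') (c *: y + y').
Proof.
move=> cxy cxy' e e0; pose K := complex.Re `|c|.
have K0 : 0 <= K by rewrite -ler0c RRe_real // ger0_real.
have e1 : 0 < e / (2 * (K + 1)) by rewrite divr_gt0 //; lra.
have e2 : 0 < e / 2 by lra.
have eE : e / 2 = (K + 1) * (e / (2 * (K + 1))).
  by rewrite invfM mulrCA [_ * (_ / _)]mulrCA mulfV ?mulr1 // gt_eqF //; lra.
have [a [b [Gab xa yb]]] := cxy _ e1; have [a' [b' [Gab' xa' yb']]] := cxy' _ e2.
exists (c *: a + a'), (c *: b + b'); split; first exact: G_lin.
- rewrite opprD addrACA -scalerBr; apply: le_lt_trans (ler_rnormD _ _) _.
  rewrite rnormZ -/K; have := rnorm_ge0 (x - a); nra.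
- rewrite opprD addrACA -scalerBr; apply: le_lt_trans (ler_rnormD _ _) _.
  rewrite rnormZ -/K; have := rnorm_ge0 (y - b); nra.
Qed.

Lemma rel_closure_iso x y : rel_closure x y -> rnorm x = rnorm y.
Proof.
move=> cxy; apply/eqP; rewrite -subr_eq0 -normr_eq0 eq_le normr_ge0 andbT.
apply/ler_addgt0Pl => e e0; rewrite addr0.
have [a [b [Gab xa yb]]] := cxy (e / 2) ltac:(lra).
have ab := G_iso Gab.
have := ler_rnormB3 x a 0; have := ler_rnormB3 a x 0.
have := ler_rnormB3 y b 0; have := ler_rnormB3 b y 0.
rewrite !subr0 (rnormBC a x) (rnormBC b y) ler_norml => *.
by apply/andP; split; lra.
Qed.

Lemma rel_closureB x y x' y' :
  rel_closure x y -> rel_closure x' y' -> rel_closure (x - x') (y - y').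
Proof.
move=> cxy cxy'; have := rel_closure_lin (-1) cxy' cxy.
by rewrite !scaleN1r ![- _ + _]addrC.
Qed.

Lemma rel_closure_fun x y y' : rel_closure x y -> rel_closure x y' -> y = y'.
Proof.
move=> cy cy'; apply/subr0_eq/rnorm_eq0.
by rewrite -(rel_closure_iso (rel_closureB cy cy')) subrr rnorm0.
Qed.

(** Isometry turns approximations of [x] by the domain into a Cauchy sequence
    of images, whose limit exists by completeness of [H2]. *)
Lemma rel_closure_total :
  (forall x (e : R), 0 < e -> exists a b, rel_closure a b /\ rnorm (x - a) < e) ->
  forall x, exists y, rel_closure x y.
Proof.
move=> dom x.
have inv_gt0 n : 0 < (n.+1%:R : R)^-1 by rewrite invr_gt0.
have /choice [f hf] : forall n, exists ab : H1 * H2,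
    rel_closure ab.1 ab.2 /\ rnorm (x - ab.1) < n.+1%:R^-1.
  by move=> n; have [a [b ?]] := dom x _ (inv_gt0 n); exists (a, b).
have inv_small (e : R) : 0 < e -> exists n0, forall n, (n0 <= n)%N -> n.+1%:R^-1 < e.
  move=> e0; have [n0 _ hn] := near_infty_natSinv_lt (PosNum e0).
  by exists n0 => n n0n; exact: hn.
have [|y yl] := @rnorm_complete R H2 (fun n => (f n).2).
  move=> e e0; have [n0 hn] := inv_small (e / 2) ltac:(lra).
  exists n0 => m n hm hn'.
  rewrite -(rel_closure_iso (rel_closureB (hf m).1 (hf n).1)).
  have := ler_rnormB3 (f m).1 x (f n).1; rewrite (rnormBC _ x).
  have := lt_trans (hf m).2 (hn _ hm); have := lt_trans (hf n).2 (hn _ hn').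
  by lra.
exists y; apply: rel_closureK => e e0.
have [n0 hn0] := inv_small _ e0; have [n1 hn1] := yl _ e0.
pose n := maxn n0 n1; exists (f n).1, (f n).2; split; first exact: (hf n).1.
- exact: lt_trans (hf n).2 (hn0 _ (leq_maxl _ _)).
- by rewrite rnormBC; apply/hn1/leq_maxr.
Qed.

End IsometricRelation.

Lemma linear_isometry_inner (R : realType) (H1 H2 : hilbertType R)
    (U : {linear H1 -> H2}) :
  (forall x, rnorm (U x) = rnorm x) -> forall x y, inner (U x) (U y) = inner x y.
Proof.
move=> Uiso x y; have nrm z : inner (U z) (U z) = inner z z.
  by rewrite !inner_rnorm Uiso.
apply: (@mulIf _ 4%:R); first by rewrite pnatr_eq0.
rewrite !mulr_natr !polarization -!linearZ -!linearD -!linearB.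
by rewrite !nrm.
Qed.

Section UnitaryOfRelation.
Variables (R : realType) (H1 H2 : hilbertType R).

Lemma rel_closure_sym (G : H1 -> H2 -> Prop) x y :
  rel_closure G x y -> rel_closure (fun b a => G a b) y x.
Proof. by move=> h e e0; have [a [b []]] := h e e0; exists b, a. Qed.

(** The domain and range hypotheses are exchanged by passing to the converse
    relation, which gives surjectivity from totality. *)
Lemma unitary_of_relation (G : H1 -> H2 -> Prop) :
  (forall (c : R[i]) a b a' b', G a b -> G a' b' -> G (c *: a + a') (c *: b + b')) ->
  (forall a b, G a b -> rnorm a = rnorm b) ->
  (forall x (e : R), 0 < e -> exists a b, rel_closure G a b /\ rnorm (x - a) < e) ->
  (forall y (e : R), 0 < e -> exists a b, rel_closure G a b /\ rnorm (y - b) < e) ->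
  exists U : {linear H1 -> H2},
    [/\ (forall y, exists x, U x = y),
        (forall x y, inner (U x) (U y) = inner x y) &
        (forall x y, rel_closure G x y <-> U x = y)].
Proof.
move=> Glin Giso dom ran.
have /choice [f cf] := rel_closure_total Glin Giso dom.
have cfun := rel_closure_fun Glin Giso.
have flin : linear f.
  by move=> c x y; apply: cfun (cf _) _; apply: rel_closure_lin.
pose U : {linear H1 -> H2} := HB.pack f (GRing.isLinear.Build _ _ _ _ f flin).
have cU x y : rel_closure G x y <-> U x = y.
  by split=> [cxy|<-]; [apply: cfun cxy; exact: cf|exact: cf].
exists U; split => //.
- move=> y; have [|||x cx] := @rel_closure_total _ _ _ (fun b a => G a b) _ _ _ y.
  + by move=> c b a b' a'; exact: Glin.
  + by move=> b a /Giso.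
  + move=> z e e0; have [a [b [cab zb]]] := ran z e e0.
    by exists b, a; split => //; exact: rel_closure_sym.
  exists x; apply/cU => e e0; have [b [a [Gab h1 h2]]] := cx e e0.
  by exists a, b.
- apply: linear_isometry_inner => x; apply/esym/(rel_closure_iso Giso).
  exact: cf.
Qed.
End UnitaryOfRelation.

(** * Intertwining by generators *)

Section EquivalenceOfRelation.
Variables (R : realType) (I : Type) (B : cstarAlgType R) (s : I -> B).
Hypothesis B_gen : forall S : set B,
  cstar_subalgebra S -> (forall i, S (s i)) -> S = setT.
Variables (H1 H2 : hilbertType R).
Variables (pi1 : representation B H1) (pi2 : representation B H2).
Variable G : H1 -> H2 -> Prop.
Hypothesis G_lin : forall (c : R[i]) a b a' b',
  G a b -> G a' b' -> G (c *: a + a') (c *: b + b').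
Hypothesis G_gen : forall i x y, G x y -> G (pi1 (s i) x) (pi2 (s i) y).
Hypothesis G_genstar : forall i x y,
  G x y -> G (pi1 (star (s i)) x) (pi2 (star (s i)) y).

Let stable a := forall x y, rel_closure G x y -> rel_closure G (pi1 a x) (pi2 a y).

Lemma rel_closure_map a :
  (forall x y, G x y -> G (pi1 a x) (pi2 a y)) -> stable a.
Proof.
move=> Ga x y cxy e e0; pose K := 2 * cnorm a.
have K0 : 0 <= K by rewrite mulr_ge0 ?cnorm_ge0.
have e1 : 0 < e / (K + 1) by rewrite divr_gt0 //; lra.
have eE : e = (K + 1) * (e / (K + 1)) by rewrite mulrC divfK // gt_eqF //; lra.
have [u [v [Guv xu yv]]] := cxy _ e1.
exists (pi1 a u), (pi2 a v); split; first exact: Ga.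
- rewrite -linearB; apply: le_lt_trans (rep_le _ _ _) _; rewrite -/K.
  have := rnorm_ge0 (x - u); nra.
- rewrite -linearB; apply: le_lt_trans (rep_le _ _ _) _; rewrite -/K.
  have := rnorm_ge0 (y - v); nra.
Qed.

Lemma rel_closure_rep_closed (u : nat -> B) l : (forall n, stable (u n)) ->
  (forall e : R, 0 < e -> exists n0, forall n, (n0 <= n)%N -> cnorm (u n - l) < e) ->
  stable l.
Proof.
move=> su ul x y cxy; apply: rel_closureK => e e0.
have K0 : 0 <= rnorm x + rnorm y by rewrite addr_ge0 ?rnorm_ge0.
set K := rnorm x + rnorm y in K0.
have e1 : 0 < e / (2 * K + 1) by rewrite divr_gt0 //; lra.
have eE : e = (2 * K + 1) * (e / (2 * K + 1)).
  by rewrite mulrC divfK // gt_eqF //; lra.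
have [n /(_ n (leqnn n)) hn] := ul _ e1.
exists (pi1 (u n) x), (pi2 (u n) y); split; first exact: su.
- rewrite -repB; apply: le_lt_trans (rep_le _ _ _) _; rewrite cnormBC.
  have := rnorm_ge0 x; have := rnorm_ge0 y; have := cnorm_ge0 (u n - l).
  by rewrite /K in eE e1 hn *; set t := e / _ in eE e1 hn; nra.
- rewrite -repB; apply: le_lt_trans (rep_le _ _ _) _; rewrite cnormBC.
  have := rnorm_ge0 x; have := rnorm_ge0 y; have := cnorm_ge0 (u n - l).
  by rewrite /K in eE e1 hn *; set t := e / _ in eE e1 hn; nra.
Qed.

(** The elements acting compatibly with the closed relation, together with
    their adjoints, form a C*-subalgebra that contains the generators. *)
Lemma rel_closure_rep a : stable a.
Proof.
suff : [set a | stable a /\ stable (star a)] = setT.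
  by move=> e; have [] : [set a | stable a /\ stable (star a)] a by rewrite e.
clear a; apply: B_gen; last first.
  by move=> i; split; apply: rel_closure_map => x y; auto.
split.
- move=> u l su /cnorm_cvgP ul; split.
    by apply: rel_closure_rep_closed ul => n; have [] := su n.
  apply: (@rel_closure_rep_closed (fun n => star (u n))).
    by move=> n; have [] := su n.
  move=> e /ul [n0 h]; exists n0 => n /h; by rewrite -starB cnorm_starE.
- by rewrite /= star1; split=> x y; rewrite !rep1.
- move=> a b [sa sa'] [sb sb']; rewrite /= starD; split=> x y cxy;
  rewrite !repD -[pi1 _ _]scale1r -[pi2 _ _]scale1r; apply: rel_closure_lin; auto.
- move=> c a [sa sa']; rewrite /= starZ; split=> x y cxy;
  rewrite !repZ -[_ *: pi1 _ _]addr0 -[_ *: pi2 _ _]addr0;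
  (apply: rel_closure_lin; first exact: G_lin; first by auto);
  rewrite -(subrr x) -(subrr y); exact: rel_closureB.
- move=> a b [sa sa'] [sb sb']; rewrite /= starM; split=> x y cxy;
  rewrite !repM; auto.
- by move=> a [sa sa']; rewrite /= starK.
Qed.

(** Cyclicity of both vectors makes the closed relation total and onto. *)
Lemma equivalent_of_relation (Om1 : H1) (Om2 : H2) :
  (forall a b, G a b -> rnorm a = rnorm b) ->
  cyclic_vector pi1 Om1 -> cyclic_vector pi2 Om2 -> G Om1 Om2 ->
  unitarily_equivalent pi1 pi2.
Proof.
move=> Giso cyc1 cyc2 GOm.
have cOm a : rel_closure G (pi1 a Om1) (pi2 a Om2).
  exact/rel_closure_rep/sub_rel_closure.
have [||U [Usurj Uinner cU]] := unitary_of_relation G_lin Giso.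
- move=> x e e0; have [_ [a _ <-] xa] := dense_rnorm x cyc1 e0.
  by exists (pi1 a Om1), (pi2 a Om2).
- move=> y e e0; have [_ [a _ <-] ya] := dense_rnorm y cyc2 e0.
  by exists (pi1 a Om1), (pi2 a Om2).
exists U; split => // a x; apply/cU/rel_closure_rep; exact/cU.
Qed.
End EquivalenceOfRelation.

(** * Word vectors in representations of Cuntz-Krieger algebras *)

Section CuntzKriegerRep.
Variables (R : realType) (N : nat) (A : 'M[bool]_N) (B : cstarAlgType R).
Variables (s : 'I_N -> B).
Hypothesis ckf : cuntz_krieger_family A s.
Variables (H : hilbertType R) (pi : representation B H).

Lemma rep_star_inner a x y : inner (pi (star a) x) y = inner x (pi a y).
Proof. by rewrite rep_star starK. Qed.

Lemma ck_rep_sum x :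
  \sum_(i < N) inner (pi (star (s i)) x) (pi (star (s i)) x) = inner x x.
Proof.
transitivity (inner (pi (\sum_(i < N) s i * star (s i)) x) x); last first.
  by rewrite (ck_sum ckf) rep1.
rewrite rep_sum dot_suml; apply: eq_bigr => i _.
by rewrite repM (rep_star pi (s i)).
Qed.

Lemma ck_rep_partial i x : pi (s i) (pi (star (s i)) (pi (s i) x)) = pi (s i) x.
Proof. by rewrite -!repM (ck_partial_isometry ckf). Qed.

(** The squared lengths of the [pi (star (s i)) y] add up to that of [y]; for
    [y = pi (s j) x] the [j]-th one already exhausts it. *)
Lemma ck_rep_orth i j x : i != j -> pi (star (s i)) (pi (s j) x) = 0.
Proof.
move=> ij; have := ck_rep_sum (pi (s j) x); rewrite (bigD1 j) //=.
have -> : inner (pi (star (s j)) (pi (s j) x)) (pi (star (s j)) (pi (s j) x)) =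
          inner (pi (s j) x) (pi (s j) x).
  by rewrite rep_star_inner ck_rep_partial.
rewrite -[X in _ = X]addr0 => /addrI /eqP; rewrite psumr_eq0; last first.
  by move=> k _; exact: dnorm_ge0.
move=> /allP /(_ i); rewrite mem_index_enum ij /= dnorm_eq0 => /(_ isT).
by move/eqP.
Qed.

(** Of the projections [s_l s_l^*] in the expansion of [s_i^* s_i] only the one
    with [l = j] survives on the range of [s_j], where it is the identity. *)
Lemma ck_rep_star i k j x : pi (star (s i)) (pi (s k) (pi (s j) x)) =
  ((i == k) && A i j)%:R *: pi (s j) x.
Proof.
have [->|ik] := eqVneq i k; last by rewrite scale0r ck_rep_orth.
rewrite -repM (ck_initial ckf) rep_sum (bigD1 j) //= big1 ?addr0; last first.
  by move=> l lj; rewrite repZ repM ck_rep_orth // linear0 scaler0.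
by rewrite repZ repM ck_rep_partial.
Qed.

(** Both kinds of defining relations in one form: [v n] is the vector reached
    from the cyclic vector [v 0] after reading the first [n] letters of [J],
    and [v] has period [p], the value [p = 0] meaning that it never repeats.
    The scalar of a closed word is spread over its letters: each step
    contributes a factor [zeta]. *)
Record word_vectors (J : nat -> 'I_N) (p : nat) (zeta : R[i]) (v : nat -> H)
    : Prop := WordVectors {
  word_vectors_step : forall n, pi (s (J n)) (v n.+1) = zeta *: v n ;
  word_vectors_inner : forall n m, inner (v n) (v m) = (n == m %[mod p])%:R ;
  word_vectors_cyclic : cyclic_vector pi (v 0%N) }.

Section WordVectors.
Variables (J : nat -> 'I_N) (p : nat) (zeta : R[i]) (v : nat -> H).
Hypothesis JA : infinite_word A J.
Hypothesis zeta0 : zeta != 0.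
Hypothesis v_step : forall n, pi (s (J n)) (v n.+1) = zeta *: v n.

(** The pair [(I, n)] stands for the vector [s_I v_n]. *)
Definition path_vector (t : seq 'I_N * nat) : H :=
  foldr (fun i => pi (s i)) (v t.2) t.1.

(** The letter whose range projection fixes the path vector. *)
Definition path_head (t : seq 'I_N * nat) : 'I_N := head (J t.2) t.1.

(** A path with no letters in front of [v n] loses a letter by advancing along
    [J]. *)
Definition path_tail (t : seq 'I_N * nat) : seq 'I_N * nat :=
  if t.1 is _ :: K then (K, t.2) else ([::], t.2.+1).

Definition path_coef (i : 'I_N) (t : seq 'I_N * nat) : R[i] :=
  if t.1 is k :: K then ((i == k) && A i (path_head (K, t.2)))%:R
  else (i == J t.2)%:R * zeta^-1.

Lemma word_vectorE n : v n = pi (s (J n)) (zeta^-1 *: v n.+1).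
Proof. by rewrite linearZ /= v_step scalerA mulVf // scale1r. Qed.

Lemma path_vector_head t : exists y, path_vector t = pi (s (path_head t)) y.
Proof.
case: t => -[|k I] n; rewrite /path_vector /path_head /=; last by eexists.
by eexists; exact: word_vectorE.
Qed.

(** The coefficient depends on [A], [J] and [zeta] but not on the
    representation; this is what makes the representation unique. *)
Lemma path_vector_star i t :
  pi (star (s i)) (path_vector t) = path_coef i t *: path_vector (path_tail t).
Proof.
case: t => -[|k I] n; rewrite /path_coef /path_tail [path_vector _]/=.
  rewrite /= [path_vector _]/= /path_vector /= word_vectorE (word_vectorE n.+1).
  rewrite -linearZ /= ck_rep_star linearZ /= -word_vectorE.
  have [->|_] /= := eqVneq i (J n); last by rewrite !mul0r !scale0r.
  by rewrite JA scale1r mul1r.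
have [y /= hy] := path_vector_head (I, n).
by rewrite /path_vector /= -/(path_vector (I, n)) hy ck_rep_star.
Qed.

End WordVectors.
End CuntzKriegerRep.

(** * Uniqueness *)

Section WordVectorsUnique.
Variables (R : realType) (N : nat) (A : 'M[bool]_N) (B : cstarAlgType R).
Variables (s : 'I_N -> B).
Hypothesis ckf : cuntz_krieger_family A s.
Hypothesis B_gen : forall S : set B,
  cstar_subalgebra S -> (forall i, S (s i)) -> S = setT.
Variables (J : nat -> 'I_N) (p : nat) (zeta : R[i]).
Hypothesis JA : infinite_word A J.
Hypothesis zeta0 : zeta != 0.
Variables (H1 H2 : hilbertType R).
Variables (pi1 : representation B H1) (pi2 : representation B H2).
Variables (v1 : nat -> H1) (v2 : nat -> H2).
Hypothesis vv1 : word_vectors s pi1 J p zeta v1.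
Hypothesis vv2 : word_vectors s pi2 J p zeta v2.

Let e1 := path_vector s pi1 v1.
Let e2 := path_vector s pi2 v2.

(** Moving the letters of one path to the other side as adjoints reduces every
    inner product to one between word vectors. *)
Lemma path_gram t u : inner (e1 t) (e1 u) = inner (e2 t) (e2 u).
Proof.
have st1 i t := path_vector_star ckf JA zeta0 (word_vectors_step vv1) i t.
have st2 i t := path_vector_star ckf JA zeta0 (word_vectors_step vv2) i t.
case: t => I n; elim: I u => [|i I IH] u; last first.
  rewrite [e1 (_, _)]/= [e2 (_, _)]/= /e1 /e2 /path_vector /=.
  rewrite !rep_star -/(path_vector s pi1 v1 _) -/(path_vector s pi2 v2 _).
  by rewrite (st1 i u) (st2 i u) !dotZr -[LHS]/(_ * inner (e1 (I, n)) (e1 _)) IH.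
case: u => K m; elim: K n => [|k K IH] n.
  by rewrite /e1 /e2 /path_vector /= (word_vectors_inner vv1) (word_vectors_inner vv2).
rewrite [e1 (k :: _, _)]/= [e2 (k :: _, _)]/= /e1 /e2 /path_vector /=.
rewrite -!rep_star_inner.
rewrite -[v1 n]/(path_vector s pi1 v1 ([::], n)) st1.
rewrite -[v2 n]/(path_vector s pi2 v2 ([::], n)) st2 !dotZl.
by congr (_ * _); exact: IH.
Qed.

Let comb (H : hilbertType R) (e : seq 'I_N * nat -> H)
  (r : seq (R[i] * (seq 'I_N * nat))) := \sum_(t <- r) t.1 *: e t.2.
(* The graph of the isometry, on the spans of the path vectors. *)
Let G a b := exists2 r, a = comb e1 r & b = comb e2 r.

Lemma word_vectors_unique : unitarily_equivalent pi1 pi2.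
Proof.
have comb_lin (H : hilbertType R) (e : _ -> H) c r r' :
    c *: comb e r + comb e r' = comb e ([seq (c * t.1, t.2) | t <- r] ++ r').
  rewrite /comb big_cat big_map scaler_sumr; congr (_ + _).
  by apply: eq_bigr => t _; rewrite scalerA.
apply: (@equivalent_of_relation _ _ _ _ B_gen _ _ _ _ G _ _ _ (v1 0) (v2 0)).
- move=> c _ _ _ _ [r -> ->] [r' -> ->].
  by exists ([seq (c * t.1, t.2) | t <- r] ++ r'); exact: comb_lin.
- move=> i _ _ [r -> ->]; exists [seq (t.1, (i :: t.2.1, t.2.2)) | t <- r];
  rewrite /comb big_map linear_sum; apply: eq_bigr => t _; exact: linearZ.
- move=> i _ _ [r -> ->].
  exists [seq (t.1 * path_coef A J zeta i t.2, path_tail t.2) | t <- r];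
  rewrite /comb big_map linear_sum; apply: eq_bigr => t _; rewrite linearZ /=.
  + rewrite (path_vector_star ckf JA zeta0 (word_vectors_step vv1)) scalerA //.
  + rewrite (path_vector_star ckf JA zeta0 (word_vectors_step vv2)) scalerA //.
- move=> _ _ [r -> ->]; apply: rnorm_inner_eq; rewrite /comb !dot_suml.
  apply: eq_bigr => t _; rewrite !dot_sumr; apply: eq_bigr => u _.
  by rewrite !dotZl !dotZr path_gram.
- exact: word_vectors_cyclic vv1.
- exact: word_vectors_cyclic vv2.
- exists [:: (1, ([::], 0%N))]; rewrite /comb big_seq1 scale1r //.
Qed.
End WordVectorsUnique.

(** * Completeness of the complex numbers *)

Section ComplexComplete.
Variable R : realType.

Lemma rnorm_complexE (z : R[i]) : rnorm (z : R[i]^o) =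
  Num.sqrt (complex.Re z ^+ 2 + complex.Im z ^+ 2).
Proof. by apply: (@complexI R); rewrite [LHS]rnormE [LHS]normc_def. Qed.

Lemma rnorm_Re (z : R[i]) : `|complex.Re z| <= rnorm (z : R[i]^o).
Proof. by rewrite rnorm_complexE -sqrtr_sqr ler_wsqrtr // lerDl sqr_ge0. Qed.

Lemma rnorm_Im (z : R[i]) : `|complex.Im z| <= rnorm (z : R[i]^o).
Proof. by rewrite rnorm_complexE -sqrtr_sqr ler_wsqrtr // lerDr sqr_ge0. Qed.

Lemma rnorm_le_ReIm (z : R[i]) :
  rnorm (z : R[i]^o) <= `|complex.Re z| + `|complex.Im z|.
Proof.
have z0 : 0 <= `|complex.Re z| + `|complex.Im z| by rewrite addr_ge0.
rewrite rnorm_complexE -(ger0_norm z0) -sqrtr_sqr ler_wsqrtr //.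
rewrite sqrrD !real_normK ?num_real // addrAC lerDl mulrn_wge0 ?mulr_ge0 //.
Qed.

Lemma complex_cauchy_cvg (F : set_system R[i]) : ProperFilter F ->
  (forall e : R, 0 < e -> exists2 D, F D &
     forall a b, D a -> D b -> rnorm (a - b : R[i]^o) < e) ->
  exists l : R[i], forall e : R, 0 < e -> F [set a | rnorm (a - l : R[i]^o) < e].
Proof.
move=> FF Fc.
have part (h : R[i] -> R) : (forall a b, h (a - b) = h a - h b) ->
    (forall a, `|h a| <= rnorm (a : R[i]^o)) ->
    exists l : R, forall e : R, 0 < e -> F [set a | `|h a - l| < e].
  move=> hB hle; have /cauchy_cvgP /cvg_ex [l hl] : cauchy (h @ F).
    apply/cauchy_ballP => e e0; have [D FD Dab] := Fc e e0.
    exists (h @` D, h @` D).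
      by split; apply: (@filterS _ F _ D) => // a Da; exists a.
    move=> [_ _] [[a Da <-] [b Db <-]]; rewrite -ball_normE /= -hB.
    by apply: le_lt_trans (hle _) _; exact: Dab.
  exists l => e e0; move/cvgrPdist_lt/(_ e e0) : hl.
  by apply: filterS => a /=; rewrite distrC.
have [||x hx] := part (@complex.Re R); [exact: raddfB | exact: rnorm_Re |].
have [||y hy] := part (@complex.Im R); [exact: raddfB | exact: rnorm_Im |].
exists (x +i* y) => e e0; have e2 : 0 < e / 2 by lra.
apply: filterS2 (hx _ e2) (hy _ e2) => a /= h1 h2.
apply: le_lt_trans (rnorm_le_ReIm _) _; case: a h1 h2 => a b /=; lra.
Qed.
End ComplexComplete.

(** * Square-summable families *)

Section UnorderedSums.
Variable X : eqType.

(** Summation over an arbitrary index set is convergence along the finite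
    duplicate-free sequences, ordered by inclusion. *)
Definition finite_sums : set_system (seq X) :=
  filter_from setT (fun u : seq X => [set t : seq X | uniq t /\ {subset u <= t}]).

#[global] Instance finite_sums_filter : ProperFilter finite_sums.
Proof.
apply: filter_from_proper.
  apply: filter_fromT_filter; first by exists [::].
  move=> u u'; exists (u ++ u') => t [tt ut].
  by split; split=> // x xu; apply: ut; rewrite mem_cat xu ?orbT.
move=> u _; exists (undup u); split; first exact: undup_uniq.
by move=> x; rewrite mem_undup.
Qed.

Lemma finite_sums_near (P : set (seq X)) (u : seq X) :
  (forall t, uniq t -> {subset u <= t} -> P t) -> finite_sums P.
Proof. by move=> h; exists u => // t [tt ut]; exact: h. Qed.

Lemma ler_sum_subset (R : numDomainType) (F : X -> R) (u t : seq X) :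
  (forall x, 0 <= F x) -> uniq u -> {subset u <= t} ->
  \sum_(x <- u) F x <= \sum_(x <- t) F x.
Proof.
move=> F0; elim: t u => [|y t IH] u uu ut.
  rewrite (_ : u = [::]) //; case: u ut {uu} => // x u /(_ x).
  by rewrite inE eqxx => /(_ isT).
rewrite big_cons; have [yu|yu] := boolP (y \in u).
  rewrite (perm_big _ (perm_to_rem yu)) big_cons lerD2l; apply: IH.
    exact: rem_uniq.
  move=> x; rewrite mem_rem_uniq // !inE => /andP[xy /ut].
  by rewrite inE (negPf xy).
apply: le_trans (IH u uu _) _; last by rewrite lerDr.
move=> x xu; have := ut x xu; rewrite inE => /predU1P[xy|//].
by rewrite -xy xu in yu.
Qed.
End UnorderedSums.
Arguments finite_sums X : clear implicits.

Section SquareSums.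
Variables (R : realType) (X : eqType).
Implicit Types (f g : X -> R[i]) (t : seq X).

Definition sqsum t f : R := \sum_(x <- t) rnorm (f x : R[i]^o) ^+ 2.

Definition square_summable f : Prop :=
  exists M : R, forall t, uniq t -> sqsum t f <= M.

Lemma sqsumD t f g : sqsum t (f + g) <= 2 * sqsum t f + 2 * sqsum t g.
Proof.
rewrite /sqsum !mulr_sumr -big_split /=; apply: ler_sum => x _.
have := ler_rnormD (f x : R[i]^o) (g x).
rewrite -[(f + g) x]/(f x + g x).
have := rnorm_ge0 (f x : R[i]^o); have := rnorm_ge0 (g x : R[i]^o).
have := rnorm_ge0 (f x + g x : R[i]^o).
set a := rnorm (_ + _); set b := rnorm _; set c := rnorm _ => a0 b0 c0 abc.
have h1 : a ^+ 2 <= (c + b) ^+ 2 by rewrite ler_pXn2r ?nnegrE ?addr_ge0.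
by have := sqr_ge0 (c - b); nra.
Qed.

Lemma sqsumZ t c f : sqsum t (c *: f) = rnorm (c : R[i]^o) ^+ 2 * sqsum t f.
Proof.
rewrite /sqsum mulr_sumr; apply: eq_bigr => x _.
by rewrite -[(c *: f) x]/(c *: (f x : R[i]^o)) rnormZ exprMn.
Qed.

Lemma sqsumE t f : (sqsum t f)%:C = \sum_(x <- t) f x * Num.conj (f x).
Proof.
rewrite /sqsum rmorph_sum; apply: eq_bigr => x _.
by rewrite rmorphXn [in LHS]/= rnormE normCK.
Qed.

Lemma square_summable0 : square_summable 0.
Proof.
exists 0 => t _; rewrite /sqsum big1 // => x _.
by rewrite -[0 x]/(0 : R[i]^o) rnorm0 expr0n.
Qed.

Lemma square_summableD f g :
  square_summable f -> square_summable g -> square_summable (f + g).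
Proof.
move=> [M hM] [M' hM']; exists (2 * M + 2 * M') => t ut.
by have := sqsumD t f g; have := hM t ut; have := hM' t ut; lra.
Qed.

Lemma square_summableZ c f : square_summable f -> square_summable (c *: f).
Proof.
move=> [M hM]; exists (rnorm (c : R[i]^o) ^+ 2 * M) => t ut.
by rewrite sqsumZ ler_wpM2l ?sqr_ge0 ?hM.
Qed.

Definition total_sqsum f : R := sup [set sqsum t f | t in [set t | uniq t]].

Lemma sqsum_le_total t f : square_summable f -> uniq t ->
  sqsum t f <= total_sqsum f.
Proof.
move=> [M hM] ut; apply: ub_le_sup; last by exists t.
by exists M => _ [u uu <-]; exact: hM.
Qed.

Lemma total_sqsum_le M f : (forall t, uniq t -> sqsum t f <= M) ->
  total_sqsum f <= M.
Proof.
move=> hM; apply: ge_sup; first by exists (sqsum [::] f), [::].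
by move=> _ [u uu <-]; exact: hM.
Qed.

(** The partial sums are monotone in the index sequence and bounded. *)
Lemma sqsum_cvg f : square_summable f ->
  (fun t => (sqsum t f)%:C : R[i]^o) @ finite_sums X --> ((total_sqsum f)%:C : R[i]^o).
Proof.
move=> sf; apply/cvgrPdist_lt => e e0.
have er : e = (complex.Re e)%:C by rewrite RRe_real // gtr0_real.
have e0' : 0 < complex.Re e by rewrite -ltr0c -er.
have [_ [u uu <-] hu] : exists2 y, [set sqsum t f | t in [set t | uniq t]] y &
    total_sqsum f - complex.Re e < y.
  apply: sup_adherent => //; split; first by exists (sqsum [::] f), [::].
  by exists (total_sqsum f) => _ [t ut <-]; exact: sqsum_le_total.
apply: (finite_sums_near (u := u)) => t ut subt.
rewrite -rmorphB /= er ger0_norm ?ler0c ?subr_ge0 ?sqsum_le_total // ltcR.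
have := @ler_sum_subset X R (fun x => rnorm (f x : R[i]^o) ^+ 2) u t.
rewrite -/(sqsum u f) -/(sqsum t f) => /(_ _ uu subt) h.
by have := h (fun x => sqr_ge0 _); lra.
Qed.

Definition dotsum t f g : R[i] := \sum_(x <- t) f x * Num.conj (g x).

Lemma dotsum_polar t f g : dotsum t f g =
  4%:R^-1 * (((sqsum t (f + g))%:C - (sqsum t (f - g))%:C)
   + 'i * ((sqsum t (f + 'i *: g))%:C - (sqsum t (f - 'i *: g))%:C)).
Proof.
apply: (@mulfI _ 4%:R); first by rewrite pnatr_eq0.
rewrite mulrA mulfV ?pnatr_eq0 // mul1r !sqsumE -!sumrB !mulr_sumr -big_split /=.
apply: eq_bigr => x _.
have eD h k : (h + k : X -> R[i]) x = h x + k x by [].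
have eN k : (- k : X -> R[i]) x = - k x by [].
have eZ k : ('i *: k : X -> R[i]) x = 'i * k x by [].
rewrite !eD !eN !eZ !rmorphD !rmorphN !rmorphM /= conjCi.
set a := f x; set b := g x; set a' := Num.conj a; set b' := Num.conj b.
transitivity (2 * (a * b' + b * a') - 2 * 'i ^+ 2 * (a * b' - b * a')).
  by rewrite sqrCi; ring.
by ring.
Qed.

Section ComplexLimits.
Context {T : Type} {F : set_system T} {FF : Filter F}.
Implicit Types (h k : T -> R[i]) (a b c : R[i]).
Local Notation C := (R[i]^o).

Lemma complex_cvgMl c h a : (h : T -> C) @ F --> (a : C) ->
  ((fun w => c * h w) : T -> C) @ F --> (c * a : C).
Proof. by move=> ha; exact: (cvgZ (cvg_cst (c : C)) ha). Qed.

Lemma complex_cvgD h k a b : (h : T -> C) @ F --> (a : C) ->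
  (k : T -> C) @ F --> (b : C) ->
  ((fun w => h w + k w) : T -> C) @ F --> (a + b : C).
Proof. by move=> ha kb; exact: (cvgD ha kb). Qed.

Lemma complex_cvgB h k a b : (h : T -> C) @ F --> (a : C) ->
  (k : T -> C) @ F --> (b : C) ->
  ((fun w => h w - k w) : T -> C) @ F --> (a - b : C).
Proof. by move=> ha kb; exact: (cvgB ha kb). Qed.

Lemma complex_cvg_conj h a : (h : T -> C) @ F --> (a : C) ->
  ((fun w => Num.conj (h w)) : T -> C) @ F --> (Num.conj a : C).
Proof.
move=> /cvgrPdist_lt ha; apply/cvgrPdist_lt => e e0.
by apply: filterS (ha e e0) => w /=; rewrite -rmorphB norm_conjC.
Qed.
End ComplexLimits.

Lemma complex_cvg_unique {T : Type} {F : set_system T} {FF : ProperFilter F}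
    (h : T -> R[i]) (a b : R[i]) :
  (h : T -> R[i]^o) @ F --> (a : R[i]^o) ->
  (h : T -> R[i]^o) @ F --> (b : R[i]^o) -> a = b.
Proof. by move=> ha hb; exact: (cvg_unique (@norm_hausdorff _ R[i]^o) ha hb). Qed.

(** By polarization a partial inner product is a combination of four partial
    sums of squares, each of which converges by monotonicity. *)
Lemma dotsum_cvg f g : square_summable f -> square_summable g ->
  cvg ((fun t => dotsum t f g : R[i]^o) @ finite_sums X).
Proof.
move=> sf sg; apply/cvg_ex.
have sN h : square_summable h -> square_summable (- h).
  by move=> sh; rewrite -scaleN1r; exact: square_summableZ.
have sig := square_summableZ 'i sg.
have cB h k : square_summable h -> square_summable k ->
    (fun t => (sqsum t (h + k))%:C - (sqsum t (h - k))%:C : R[i]^o) @ finite_sums X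
      --> ((total_sqsum (h + k))%:C - (total_sqsum (h - k))%:C : R[i]^o).
  move=> sh sk; apply: complex_cvgB; apply: sqsum_cvg;
  apply: square_summableD => //; exact: sN.
exists (4%:R^-1 * (((total_sqsum (f + g))%:C - (total_sqsum (f - g))%:C)
   + 'i * ((total_sqsum (f + 'i *: g))%:C - (total_sqsum (f - 'i *: g))%:C))).
under eq_fun do rewrite dotsum_polar.
apply: complex_cvgMl; apply: complex_cvgD; first exact: cB.
by apply: complex_cvgMl; exact: cB.
Qed.
End SquareSums.

(** * The Hilbert space of square-summable families *)

Section L2.
Variables (R : realType) (X : eqType).

Definition l2_pred : {pred X -> R[i]} := fun f => `[< square_summable f >].

Fact l2_pred_closed : submod_closed l2_pred.
Proof.
split; first exact/asboolP/square_summable0.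
move=> c f g /asboolP sf /asboolP sg; apply/asboolP.
exact/square_summableD/sg/square_summableZ.
Qed.

HB.instance Definition _ :=
  GRing.isSubmodClosed.Build R[i] (X -> R[i]) l2_pred l2_pred_closed.

Record l2 := L2 { l2_fun : X -> R[i] ; l2_mem : l2_fun \in l2_pred }.
HB.instance Definition _ := [isSub for l2_fun].
HB.instance Definition _ := [Choice of l2 by <:].
HB.instance Definition _ := [SubChoice_isSubLmodule of l2 by <:].

Lemma l2P (f : l2) : square_summable (l2_fun f).
Proof. exact/asboolP/(l2_mem f). Qed.

Definition mk_l2 (f : X -> R[i]) (sf : square_summable f) : l2 :=
  L2 (asboolT sf : f \in l2_pred).

Lemma l2_funD (f g : l2) x : l2_fun (f + g) x = l2_fun f x + l2_fun g x.
Proof. by []. Qed.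
Lemma l2_funZ c (f : l2) x : l2_fun (c *: f) x = c * l2_fun f x.
Proof. by []. Qed.
Lemma l2_funN (f : l2) x : l2_fun (- f) x = - l2_fun f x.
Proof. by []. Qed.
Lemma l2_fun0 x : l2_fun 0 x = 0.
Proof. by []. Qed.

Lemma l2_ext (f g : l2) : l2_fun f =1 l2_fun g -> f = g.
Proof. by move=> fg; apply/val_inj/funext. Qed.

Definition l2_inner (f g : l2) : R[i] :=
  lim ((fun t => dotsum t (l2_fun f) (l2_fun g) : R[i]^o) @ finite_sums X).

Lemma l2_inner_cvg f g :
  (fun t => dotsum t (l2_fun f) (l2_fun g) : R[i]^o) @ finite_sums X
    --> (l2_inner f g : R[i]^o).
Proof. exact: dotsum_cvg (l2P f) (l2P g). Qed.

Arguments l2_inner_cvg : clear implicits.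

Lemma l2_inner_unique f g (c : R[i]) (h : seq X -> R[i]) :
  (h : seq X -> R[i]^o) @ finite_sums X --> (c : R[i]^o) ->
  (forall t, dotsum t (l2_fun f) (l2_fun g) = h t) -> l2_inner f g = c.
Proof.
move=> hc /funext e; rewrite -e in hc.
exact: (complex_cvg_unique (l2_inner_cvg f g) hc).
Qed.

Lemma l2_innerC f g : l2_inner f g = Num.conj (l2_inner g f).
Proof.
apply: (l2_inner_unique (complex_cvg_conj (l2_inner_cvg g f))) => t.
rewrite /dotsum rmorph_sum.
by apply: eq_bigr => x _; rewrite rmorphM /= conjCK mulrC.
Qed.

Lemma l2_inner_linear g : linear_for *%R (l2_inner^~ g).
Proof.
move=> c f f'.
apply: (l2_inner_unique (complex_cvgD (complex_cvgMl (c := c) (l2_inner_cvg f g))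
  (l2_inner_cvg f' g))) => t; rewrite /dotsum mulr_sumr.
rewrite -big_split; apply: eq_bigr => x _.
by rewrite l2_funD l2_funZ mulrDl mulrA.
Qed.

Lemma l2_inner_semilinear f :
  linear_for (@Num.conj R[i] \; *%R) (l2_inner f).
Proof.
move=> c g g'; rewrite l2_innerC l2_inner_linear rmorphD rmorphM /=.
by rewrite -!l2_innerC.
Qed.

HB.instance Definition _ := bilinear_isBilinear.Build R[i] l2 l2 R[i]
  (GRing.Scale.Law.clone _ _ ( *%R ) _)
  (GRing.Scale.Law.clone _ _ (@Num.conj R[i] \; *%R ) _)
  l2_inner (l2_inner_linear, l2_inner_semilinear).

Fact l2_inner_hermitian f g :
  l2_inner f g = (-1) ^+ false * Num.conj (l2_inner g f).
Proof. by rewrite mul1r l2_innerC. Qed.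

HB.instance Definition _ := @isHermitianSesquilinear.Build R[i] l2 false
  (@Num.conj R[i]) l2_inner l2_inner_hermitian.

Lemma l2_inner_sqsum f : l2_inner f f = (total_sqsum (l2_fun f))%:C.
Proof.
by apply: (l2_inner_unique (sqsum_cvg (l2P f))) => t; rewrite sqsumE.
Qed.

Fact l2_inner_gt0 f : f != 0 -> 0 < l2_inner f f.
Proof.
move=> f0; rewrite l2_inner_sqsum ltr0c.
have [x fx] : exists x, l2_fun f x != 0.
  apply: contrapT => h; move/eqP: f0; apply; apply: l2_ext => x.
  by rewrite l2_fun0; apply: contrapT => /eqP fx; apply: h; exists x.
apply: lt_le_trans (@sqsum_le_total _ _ [:: x] _ (l2P f) isT).
rewrite /sqsum big_seq1 exprn_gt0 // lt_def rnorm_ge0 andbT.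
by apply: contra fx => /eqP /rnorm_eq0 ->.
Qed.

HB.instance Definition _ := isDotProduct.Build R[i] l2 l2_inner l2_inner_gt0.

Definition l2_form : {dot l2 for @Num.conj R[i]} := l2_inner.

Definition l2_norm (f : l2) : R[i] := sqrtC (l2_form f f).

Fact l2_normD f g : l2_norm (f + g) <= l2_norm f + l2_norm g.
Proof. exact: triangle_inequality. Qed.

Fact l2_normZ c f : l2_norm (c *: f) = `|c| * l2_norm f.
Proof.
rewrite /l2_norm dnormZ rootCMr ?exprn_ge0 // sqrCK //.
Qed.

Fact l2_norm_eq0 f : l2_norm f = 0 -> f = 0.
Proof. by move/eqP; rewrite sqrt_dnorm_eq0 => /eqP. Qed.

HB.instance Definition _ :=
  Lmodule_isNormed.Build R[i] l2 l2_normD l2_normZ l2_norm_eq0.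

Lemma l2_rnorm (f : l2) : rnorm f ^+ 2 = total_sqsum (l2_fun f).
Proof.
apply: (@complexI R); rewrite -l2_inner_sqsum rmorphXn [in LHS]/= rnormE.
exact: sqrtCK.
Qed.

Lemma l2_rnorm_sqsum (f : l2) t : uniq t -> sqsum t (l2_fun f) <= rnorm f ^+ 2.
Proof. by move=> ut; rewrite l2_rnorm; exact: sqsum_le_total (l2P f) ut. Qed.

Lemma l2_rnorm_le (f : l2) (M : R) : 0 <= M ->
  (forall t, uniq t -> sqsum t (l2_fun f) <= M ^+ 2) -> rnorm f <= M.
Proof.
move=> M0 h; rewrite -(@ler_pXn2r _ 2) ?nnegrE ?rnorm_ge0 // l2_rnorm.
exact: total_sqsum_le.
Qed.

Lemma l2_rnorm_coord (f : l2) x : rnorm (l2_fun f x : R[i]^o) <= rnorm f.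
Proof.
rewrite -(@ler_pXn2r _ 2) ?nnegrE ?rnorm_ge0 //.
by have := @l2_rnorm_sqsum f [:: x] isT; rewrite /sqsum big_seq1.
Qed.

(** A Cauchy filter converges coordinatewise to some [g]. Finite partial sums of
    [|f - g|^2] are controlled by those of [|f - h|^2], for [h] far along the
    filter and close to [g] on the finitely many coordinates involved, so the
    bound passes to the whole sum. *)
Lemma l2_complete (F : set_system l2) : ProperFilter F -> cauchy F -> cvg F.
Proof.
move=> FF /cauchy_ballP Fc.
have Fcauchy (e : R) : 0 < e -> exists2 D, F D &
    forall f g, D f -> D g -> rnorm (f - g) < e.
  move=> e0; have [|[D D'] [/= FD FD'] DD'] := Fc e%:C; first by rewrite ltr0c.
  have e2 : 0 < e by [].
  exists (D `&` D'); first exact: filterI.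
  move=> f g [Df _] [_ Dg]; have := DD' (f, g) (conj Df Dg).
  by rewrite -ball_normE /= -rnormE ltcR.
have /choice [g hg] : forall x, exists l : R[i], forall e : R, 0 < e ->
    F [set f | rnorm (l2_fun f x - l : R[i]^o) < e].
  move=> x; have FFx : ProperFilter ((fun f : l2 => l2_fun f x) @ F).
    exact: fmap_proper_filter.
  have [|l hl] := @complex_cauchy_cvg R ((fun f : l2 => l2_fun f x) @ F) FFx.
    move=> e e0; have [D FD hD] := Fcauchy e e0.
    exists ((fun f : l2 => l2_fun f x) @` D).
      by apply: (@filterS _ F _ D) => // f Df; exists f.
    move=> _ _ [f Df <-] [f' Df' <-]; apply: le_lt_trans (hD f f' Df Df').
    exact: l2_rnorm_coord (f - f') x.
  by exists l.
have key (e : R) : 0 < e -> exists2 D, F D &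
    forall f t, D f -> uniq t -> sqsum t (l2_fun f - g) <= e ^+ 2.
  move=> e0; have [D FD hD] := Fcauchy (e / 2) ltac:(lra).
  exists D => // f t Df ut.
  suff : forall d : R, 0 < d -> sqsum t (l2_fun f - g) <= 2 * (e / 2) ^+ 2 + d.
    move=> h; have : 2 * (e / 2) ^+ 2 <= e ^+ 2 by nra.
    by move=> h2; apply: le_trans h2; apply/ler_addgt0Pr => d /h.
  (* The error is shared out among the coordinates; [t] may be empty. *)
  move=> d d0; pose n : R := (size t)%:R + 1.
  have n0 : 0 < n by rewrite /n ltr_wpDl.
  have d1 : 0 < Num.sqrt (d / (2 * n)) by rewrite sqrtr_gt0 divr_gt0 // mulr_gt0.
  have Ft : F [set h | forall x, x \in t ->
      rnorm (l2_fun h x - g x : R[i]^o) < Num.sqrt (d / (2 * n))].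
    elim: t {ut n0} n d1 => [|x t IH] n d1; first by apply: filterE => h x.
    apply: filterS2 (hg x _ d1) (IH _ d1) => h hx ht y.
    by rewrite inE => /predU1P[->|/ht].
  have [h [Dh ht]] := filter_ex (filterI FD Ft).
  rewrite (_ : l2_fun f - g = l2_fun (f - h) + (l2_fun h - g)); last first.
    by apply/funext => x; rewrite /GRing.add /= [in RHS]addrA subrK.
  apply: le_trans (sqsumD _ _ _) _; apply: lerD.
    rewrite ler_pM2l //; apply: le_trans (l2_rnorm_sqsum _ ut) _.
    by rewrite ler_pXn2r ?nnegrE ?rnorm_ge0 //; [exact/ltW/hD | lra].
  have : sqsum t (l2_fun h - g) <= \sum_(x <- t) d / (2 * n).
    rewrite /sqsum big_seq [leRHS]big_seq; apply: ler_sum => x xt.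
    rewrite -[leRHS]sqr_sqrtr; last by rewrite divr_ge0 ?mulr_ge0 ?ltW.
    by rewrite ler_pXn2r ?nnegrE ?rnorm_ge0 ?sqrtr_ge0 //; exact/ltW/ht.
  rewrite big_const_seq count_predT iter_addr_0 => hs.
  have : d / (2 * n) *+ size t <= d / 2.
    rewrite -mulr_natr (_ : _ * _ = d / 2 * ((size t)%:R / n)); last first.
      by field; rewrite gt_eqF.
    by rewrite ler_piMr ?divr_ge0 ?ltW // ltr_pdivrMr // mul1r /n ltrDl.
  by lra.
have sg : square_summable g.
  have [D FD hD] := key 1 ltr01; have [f Df] := filter_ex FD.
  have -> : g = l2_fun f + (-1) *: (l2_fun f - g).
    by rewrite scaleN1r opprB addrC subrK.
  apply: square_summableD (l2P f) (square_summableZ _ _).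
  by exists (1 ^+ 2) => t; exact: hD.
apply/cvg_ex; exists (mk_l2 sg); apply/cvgrPdist_le => e e0.
have er : e = (complex.Re e)%:C by rewrite RRe_real // gtr0_real.
have e0' : 0 < complex.Re e by rewrite -ltr0c -er.
have [D FD hD] := key _ e0'; apply: filterS FD => f Df.
rewrite distrC -rnormE er lecR; apply: l2_rnorm_le; first exact: ltW.
by move=> t ut; exact: hD.
Qed.

HB.instance Definition _ := Uniform_isComplete.Build l2 l2_complete.

Fact l2_inner_norm (f : l2) : `|f| ^+ 2 = l2_form f f.
Proof. exact: sqrtCK. Qed.

HB.instance Definition _ := isHilbert.Build R l2 l2_inner_norm.

End L2.
Arguments l2_inner_cvg {R X} f g.

(** * The C*-algebra of adjointable operators *)

Section BoundedOperators.
Variables (R : realType) (H : hilbertType R).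
Implicit Types (T S : H -> H) (x y : H).

Lemma inner_ext x y : (forall z, inner z x = inner z y) -> x = y.
Proof.
move=> h; apply/subr0_eq/eqP; rewrite -(dnorm_eq0 (@inner R H)).
by rewrite dotBr h subrr.
Qed.

Lemma inner_extl x y : (forall z, inner x z = inner y z) -> x = y.
Proof. by move=> h; apply: inner_ext => z; rewrite dotC h -dotC. Qed.

Definition bounded_op T : Prop :=
  exists2 M : R, 0 <= M & forall x, rnorm (T x) <= M * rnorm x.

Definition adjoint_pair T S : Prop := forall x y, inner (T x) y = inner x (S y).

(** The existence of an adjoint entails linearity, and asking both maps to be
    bounded makes the definition symmetric in them. *)
Definition adjointable T : Prop :=
  exists S, [/\ adjoint_pair T S, bounded_op T & bounded_op S].

Lemma adjoint_pair_sym T S : adjoint_pair T S -> adjoint_pair S T.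
Proof. by move=> h x y; rewrite dotC -h -dotC. Qed.

Lemma adjoint_pair_unique T S S' :
  adjoint_pair T S -> adjoint_pair T S' -> S = S'.
Proof.
by move=> h h'; apply/funext => y; apply: inner_ext => x; rewrite -h -h'.
Qed.

Lemma adjoint_pair_linear T S : adjoint_pair T S -> linear T.
Proof.
move=> h c x y; apply: inner_extl => z.
by rewrite h !dotDl !dotZl -!h.
Qed.

Lemma bounded_opD T S : bounded_op T -> bounded_op S -> bounded_op (T + S).
Proof.
move=> [M M0 hM] [K K0 hK]; exists (M + K); first exact: addr_ge0.
move=> x; apply: le_trans (ler_rnormD _ _) _.
by rewrite mulrDl lerD.
Qed.

Lemma bounded_opZ c T : bounded_op T -> bounded_op (c *: T).
Proof.
move=> [M M0 hM]; have c0 : 0 <= complex.Re `|c|.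
  by rewrite -ler0c RRe_real // ger0_real.
exists (complex.Re `|c| * M); first exact: mulr_ge0.
by move=> x; rewrite [X in X <= _]rnormZ -mulrA ler_wpM2l.
Qed.

Lemma bounded_op_comp T S : bounded_op T -> bounded_op S -> bounded_op (T \o S).
Proof.
move=> [M M0 hM] [K K0 hK]; exists (M * K); first exact: mulr_ge0.
by move=> x; apply: le_trans (hM _) _; rewrite -mulrA ler_wpM2l.
Qed.

Lemma adjoint_pairD T S T' S' : adjoint_pair T S -> adjoint_pair T' S' ->
  adjoint_pair (T + T') (S + S').
Proof.
move=> h h' x y; rewrite -[(T + T') x]/(T x + T' x) -[(S + S') y]/(S y + S' y).
by rewrite dotDl dotDr h h'.
Qed.

Lemma adjoint_pairZ c T S :
  adjoint_pair T S -> adjoint_pair (c *: T) (Num.conj c *: S).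
Proof.
move=> h x y; rewrite -[(c *: T) x]/(c *: T x).
by rewrite -[(_ *: S) y]/(_ *: S y) dotZl dotZr conjCK h.
Qed.

Lemma adjoint_pair_comp T S T' S' : adjoint_pair T S -> adjoint_pair T' S' ->
  adjoint_pair (T \o T') (S' \o S).
Proof. by move=> h h' x y; rewrite /= h h'. Qed.

Definition bop_pred : {pred H -> H} := fun T => `[< adjointable T >].

Fact bop_pred_closed : submod_closed bop_pred.
Proof.
split.
  have b0 : bounded_op 0.
    by exists 0 => // x; rewrite -[0 x]/(0 : H) rnorm0 mul0r.
  apply/asboolP; exists 0; split => // x y.
  by rewrite -[0 x]/(0 : H) -[0 y]/(0 : H) dot0l dot0r.
move=> c T T' /asboolP [S [hTS bT bS]] /asboolP [S' [hTS' bT' bS']].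
apply/asboolP; exists (Num.conj c *: S + S'); split.
- exact/adjoint_pairD/hTS'/adjoint_pairZ.
- exact/bounded_opD/bT'/bounded_opZ.
- exact/bounded_opD/bS'/bounded_opZ.
Qed.

HB.instance Definition _ :=
  GRing.isSubmodClosed.Build R[i] (H -> H) bop_pred bop_pred_closed.
End BoundedOperators.

(** The nonzero vector in [nt] is there for the sake of [1 != 0], which the
    structure of algebra demands. *)
Record bop (R : realType) (H : hilbertType R) (nt : exists w : H, w != 0) :=
  Bop { bop_fun : H -> H ; bop_mem : bop_fun \in @bop_pred R H }.

Section BopAlgebra.
Variables (R : realType) (H : hilbertType R) (nt : exists w : H, w != 0).
Local Notation bop := (bop nt).

HB.instance Definition _ := [isSub for @bop_fun R H nt].
HB.instance Definition _ := [Choice of bop by <:].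
HB.instance Definition _ := [SubChoice_isSubLmodule of bop by <:].
Implicit Types (a b : bop) (x y : H).

Lemma bop_ext a b : bop_fun a =1 bop_fun b -> a = b.
Proof. by move=> ab; apply/val_inj/funext. Qed.

Lemma bop_adjointable a : adjointable (bop_fun a).
Proof. exact/asboolP/(bop_mem a). Qed.

Definition mk_bop T (hT : adjointable T) : bop :=
  Bop nt (asboolT hT : T \in @bop_pred R H).

Lemma bop_funD a b x : bop_fun (a + b) x = bop_fun a x + bop_fun b x.
Proof. by []. Qed.
Lemma bop_funZ c a x : bop_fun (c *: a) x = c *: bop_fun a x.
Proof. by []. Qed.
Lemma bop_fun0 x : bop_fun (0 : bop) x = 0.
Proof. by []. Qed.

Lemma bop_star_subproof a : adjointable (projT1 (cid (bop_adjointable a))).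
Proof.
case: (cid _) => S /= [hS bT bS]; exists (bop_fun a); split => //.
exact: adjoint_pair_sym.
Qed.

Definition bop_star a : bop := mk_bop (bop_star_subproof a).

Lemma bop_adjoint a x y : inner (bop_fun a x) y = inner x (bop_fun (bop_star a) y).
Proof. by rewrite /bop_star /=; case: (cid _) => S [hS _ _] /=. Qed.

Lemma bop_star_unique a b :
  (forall x y, inner (bop_fun a x) y = inner x (bop_fun b y)) -> bop_star a = b.
Proof.
move=> h; apply: bop_ext => y; apply: inner_ext => x.
by rewrite -bop_adjoint h.
Qed.

Lemma bop_linear a : linear (bop_fun a).
Proof.
apply: (@adjoint_pair_linear _ _ _ (bop_fun (bop_star a))) => x y.
exact: bop_adjoint.
Qed.

Lemma bop_one_subproof : adjointable (@id H).
Proof.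
have b1 : bounded_op (@id H) by exists 1 => // x; rewrite mul1r.
by exists id; split.
Qed.
Definition bop_one : bop := mk_bop bop_one_subproof.

Lemma bop_mul_subproof a b : adjointable (bop_fun a \o bop_fun b).
Proof.
have [S [hS bT bS]] := bop_adjointable a.
have [S' [hS' bT' bS']] := bop_adjointable b.
by exists (S' \o S); split; [exact: adjoint_pair_comp|exact: bounded_op_comp..].
Qed.
Definition bop_mul a b : bop := mk_bop (bop_mul_subproof a b).

Fact bop_mulA : associative bop_mul.
Proof. by move=> a b c; exact: bop_ext. Qed.
Fact bop_mul1l : left_id bop_one bop_mul.
Proof. by move=> a; exact: bop_ext. Qed.
Fact bop_mul1r : right_id bop_one bop_mul.
Proof. by move=> a; exact: bop_ext. Qed.
Fact bop_mulDl : left_distributive bop_mul +%R.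
Proof. by move=> a b c; exact: bop_ext. Qed.
Fact bop_mulDr : right_distributive bop_mul +%R.
Proof.
move=> a b c; apply: bop_ext => x.
have := bop_linear a 1 (bop_fun b x) (bop_fun c x); rewrite !scale1r.
exact.
Qed.
Fact bop_one_neq0 : bop_one != 0.
Proof.
apply/eqP => e; have [w /eqP] := nt; apply.
by have := bop_fun0 w; rewrite -e.
Qed.

HB.instance Definition _ := GRing.Zmodule_isNzRing.Build bop
  bop_mulA bop_mul1l bop_mul1r bop_mulDl bop_mulDr bop_one_neq0.

Fact bop_scaleAl (c : R[i]) a b : c *: (a * b) = (c *: a) * b.
Proof. by apply: bop_ext. Qed.
HB.instance Definition _ := GRing.Lmodule_isLalgebra.Build R[i] bop bop_scaleAl.
Fact bop_scaleAr (c : R[i]) a b : c *: (a * b) = a * (c *: b).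
Proof.
apply: bop_ext => x; rewrite bop_funZ /=.
have a0 : bop_fun a 0 = 0.
  by have := bop_linear a (-1) 0 0; rewrite addr0 scaler0 scaleN1r addNr.
by have := bop_linear a c (bop_fun b x) 0; rewrite !addr0 a0 !addr0.
Qed.
HB.instance Definition _ := GRing.Lalgebra_isAlgebra.Build R[i] bop bop_scaleAr.

Lemma bop_funM a b x : bop_fun (a * b) x = bop_fun a (bop_fun b x).
Proof. by []. Qed.
Lemma bop_funB a x y : bop_fun a (x - y) = bop_fun a x - bop_fun a y.
Proof. by rewrite addrC -scaleN1r bop_linear scaleN1r addrC. Qed.
Lemma bop_funfZ c a x : bop_fun a (c *: x) = c *: bop_fun a x.
Proof.
by rewrite -[c *: x]addr0 bop_linear -(subrr 0) bop_funB subrr addr0.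
Qed.

Definition opnorm a : R := sup [set rnorm (bop_fun a x) | x in [set x : H | rnorm x <= 1]].

Lemma opnorm_le a (M : R) : (forall x, rnorm (bop_fun a x) <= M * rnorm x) ->
  0 <= M -> opnorm a <= M.
Proof.
move=> hM M0; apply: ge_sup.
  by exists (rnorm (bop_fun a 0)), 0 => //=; rewrite rnorm0.
move=> _ [x x1 <-]; apply: le_trans (hM x) _.
by rewrite -[leRHS]mulr1 ler_wpM2l.
Qed.

Lemma opnorm_ub a x : rnorm x <= 1 -> rnorm (bop_fun a x) <= opnorm a.
Proof.
move=> x1; apply: ub_le_sup; last by exists x.
have [_ [_ [M M0 hM] _]] := bop_adjointable a.
exists M => _ [y y1 <-]; apply: le_trans (hM y) _.
by rewrite -[leRHS]mulr1 ler_wpM2l.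
Qed.

Lemma opnorm_ge0 a : 0 <= opnorm a.
Proof.
apply: le_trans (@opnorm_ub a 0 _); last by rewrite rnorm0.
exact: rnorm_ge0.
Qed.

Lemma le_opnorm a x : rnorm (bop_fun a x) <= opnorm a * rnorm x.
Proof.
have [x0|x0] := eqVneq (rnorm x) 0.
  have -> : x = 0 by exact: rnorm_eq0.
  by rewrite -(subrr 0) bop_funB !subrr !rnorm0 mulr0.
have xp : 0 < rnorm x by rewrite lt_def x0 rnorm_ge0.
have xi : 0 <= (rnorm x)^-1 by rewrite invr_ge0 ltW.
have := @opnorm_ub a ((rnorm x)^-1%:C *: x).
rewrite bop_funfZ !rnormZr // mulVf // => /(_ (lexx _)).
by rewrite mulrC ler_pdivrMr.
Qed.

Fact opnorm_eq0 a : opnorm a = 0 -> a = 0.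
Proof.
move=> a0; apply: bop_ext => x; apply: rnorm_eq0; apply/eqP.
by rewrite eq_le rnorm_ge0 andbT; have := le_opnorm a x; rewrite a0 mul0r.
Qed.

Fact opnormD a b : opnorm (a + b) <= opnorm a + opnorm b.
Proof.
apply: opnorm_le; last by rewrite addr_ge0 ?opnorm_ge0.
move=> x; rewrite bop_funD mulrDl; apply: le_trans (ler_rnormD _ _) _.
by rewrite lerD ?le_opnorm.
Qed.

Fact opnormZ (c : R[i]) a : (opnorm (c *: a))%:C = `|c| * (opnorm a)%:C.
Proof.
have cr (d : R[i]) : `|d| = (complex.Re `|d|)%:C by rewrite RRe_real // ger0_real.
have c0 (d : R[i]) : 0 <= complex.Re `|d| by rewrite -ler0c -cr.
have le d b : opnorm (d *: b) <= complex.Re `|d| * opnorm b.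
  apply: opnorm_le; last by rewrite mulr_ge0 ?opnorm_ge0.
  by move=> x; rewrite bop_funZ rnormZ -mulrA ler_wpM2l ?le_opnorm.
rewrite cr -rmorphM; congr (_%:C); apply/eqP; rewrite eq_le le andTb.
have [->|cn0] := eqVneq c 0; first by rewrite normr0 mul0r opnorm_ge0.
have cp : 0 < complex.Re `|c| by rewrite -ltr0c -cr normr_gt0.
have := le c^-1 (c *: a); rewrite scalerA mulVf // scale1r normfV.
rewrite -ler_pdivlMl //; congr (_ <= _ * _).
apply: (@complexI R); rewrite [RHS]fmorphV -normfV.
by apply: etrans (esym (cr _)) _; rewrite normfV; congr _^-1; exact: cr.
Qed.

Fact opnormM a b : opnorm (a * b) <= opnorm a * opnorm b.
Proof.
apply: opnorm_le; last by rewrite mulr_ge0 ?opnorm_ge0.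
move=> x; rewrite bop_funM -mulrA; apply: le_trans (le_opnorm _ _) _.
by rewrite ler_wpM2l ?opnorm_ge0 ?le_opnorm.
Qed.

Fact bop_starK : involutive bop_star.
Proof.
by move=> a; apply: bop_star_unique => x y; rewrite dotC -bop_adjoint -dotC.
Qed.

Fact bop_starD a b : bop_star (a + b) = bop_star a + bop_star b.
Proof.
apply: bop_star_unique => x y.
by rewrite !bop_funD dotDl dotDr !bop_adjoint.
Qed.

Fact bop_starZ (c : R[i]) a : bop_star (c *: a) = Num.conj c *: bop_star a.
Proof.
apply: bop_star_unique => x y.
by rewrite !bop_funZ dotZl dotZr conjCK bop_adjoint.
Qed.

Fact bop_starM a b : bop_star (a * b) = bop_star b * bop_star a.
Proof. by apply: bop_star_unique => x y; rewrite !bop_funM !bop_adjoint. Qed.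

Lemma rnorm_bop_le a x : rnorm (bop_fun a x) ^+ 2 <=
  opnorm (bop_star a * a) * rnorm x ^+ 2.
Proof.
rewrite -lecR -inner_rnorm bop_adjoint -bop_funM.
apply: le_trans (real_ler_norm _) _.
  by rewrite bop_funM -bop_adjoint inner_rnorm; apply/complex_realP; eexists.
rewrite dotC norm_conjC; apply: le_trans (inner_le_rnorm _ _) _.
rewrite lecR expr2 mulrA ler_wpM2r ?rnorm_ge0 //; exact: le_opnorm.
Qed.

Lemma opnorm_sqr_le a : opnorm a ^+ 2 <= opnorm (bop_star a * a).
Proof.
have m0 := opnorm_ge0 (bop_star a * a).
rewrite -[leRHS]sqr_sqrtr // ler_pXn2r ?nnegrE ?opnorm_ge0 ?sqrtr_ge0 //.
apply: opnorm_le; last exact: sqrtr_ge0.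
move=> x; rewrite -(@ler_pXn2r _ 2) ?nnegrE ?rnorm_ge0 //; last first.
  by rewrite mulr_ge0 ?sqrtr_ge0 ?rnorm_ge0.
by rewrite exprMn sqr_sqrtr // rnorm_bop_le.
Qed.

Lemma opnorm_star a : opnorm (bop_star a) = opnorm a.
Proof.
suff le b : opnorm b <= opnorm (bop_star b).
  by apply/eqP; rewrite eq_le le andbT -{2}(bop_starK a) le.
have [->|b0] := eqVneq (opnorm b) 0; first exact: opnorm_ge0.
have bp : 0 < opnorm b by rewrite lt_def b0 opnorm_ge0.
rewrite -(ler_pM2r bp) -expr2; exact: le_trans (opnorm_sqr_le b) (opnormM _ _).
Qed.

Fact opnorm_cstar a : opnorm (bop_star a * a) = opnorm a ^+ 2.
Proof.
apply/eqP; rewrite eq_le opnorm_sqr_le andbT.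
by apply: le_trans (opnormM _ _) _; rewrite opnorm_star.
Qed.

(** The pointwise limit of a Cauchy sequence is approached uniformly on the unit
    ball; the same statement applied to the adjoints yields the adjoint of the
    limit. *)
Lemma bop_pointwise_limit (u : nat -> bop) :
  (forall e : R, 0 < e -> exists n0 : nat, forall m n : nat,
     (n0 <= m)%N -> (n0 <= n)%N -> opnorm (u m - u n) < e) ->
  exists f : H -> H,
    forall e : R, 0 < e -> exists n0 : nat, forall n x,
      (n0 <= n)%N -> rnorm (bop_fun (u n) x - f x) <= e * rnorm x.
Proof.
move=> uc.
have uB m n x : rnorm (bop_fun (u m) x - bop_fun (u n) x) <=
    opnorm (u m - u n) * rnorm x.
  exact: le_opnorm (u m - u n) x.
have /choice [f hf] : forall x, exists l, forall e : R, 0 < e ->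
    exists n0, forall n, (n0 <= n)%N -> rnorm (bop_fun (u n) x - l) < e.
  move=> x; apply: rnorm_complete => e e0; have x0 := rnorm_ge0 x.
  have e1 : 0 < e / (rnorm x + 1) by rewrite divr_gt0 //; lra.
  have eE : e = e / (rnorm x + 1) * (rnorm x + 1).
    by rewrite divfK // gt_eqF //; lra.
  have [n0 h] := uc _ e1; exists n0 => m n hm hn.
  have := h m n hm hn; have := uB m n x.
  by set t := e / _ in eE e1 *; nra.
exists f => e e0; have [n0 h] := uc e e0; exists n0 => n x hn.
apply/ler_addgt0Pr => d d0; have [n1 h1] := hf x d d0.
pose m := maxn n0 n1; have := h1 m (leq_maxr _ _).
have := h n m hn (leq_maxl _ _); have := uB n m x; have := rnorm_ge0 x.
have := ler_rnormB3 (bop_fun (u n) x) (bop_fun (u m) x) (f x).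
by nra.
Qed.

Fact bop_complete (u : nat -> bop) :
  (forall e : R, 0 < e -> exists n0 : nat, forall m n : nat,
     (n0 <= m)%N -> (n0 <= n)%N -> opnorm (u m - u n) < e) ->
  exists l, (fun n => opnorm (u n - l)) @ \oo --> (0 : R).
Proof.
move=> uc; have [f hf] := bop_pointwise_limit uc.
have [|g hg] := @bop_pointwise_limit (fun n => bop_star (u n)).
  move=> e e0; have [n0 h] := uc e e0; exists n0 => m n hm hn.
  have starB (a b : bop) : bop_star a - bop_star b = bop_star (a - b).
    by rewrite bop_starD -scaleN1r -[- b]scaleN1r bop_starZ rmorphN rmorph1.
  by rewrite starB opnorm_star h.
have bnd (v : nat -> bop) (k : H -> H) : (forall e : R, 0 < e -> exists n0 : nat,
    forall n x, (n0 <= n)%N -> rnorm (bop_fun (v n) x - k x) <= e * rnorm x) ->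
    bounded_op k.
  move=> hk; have [n h] := hk 1 ltr01.
  exists (opnorm (v n) + 1) => [|x]; first by rewrite addr_ge0 ?opnorm_ge0.
  have := h n x (leqnn n); have := le_opnorm (v n) x.
  have := ler_rnormB3 (k x) (bop_fun (v n) x) 0.
  by rewrite !subr0 (rnormBC (k x)); lra.
have fg : adjoint_pair f g.
  move=> x y; apply/subr0_eq/eqP; rewrite -normr_eq0 eq_le normr_ge0 andbT.
  have nr (z : R[i]) : `|z| = (complex.Re `|z|)%:C by rewrite RRe_real // ger0_real.
  rewrite nr lecR; apply/ler_addgt0Pr => e e0; rewrite add0r -lecR -nr.
  have K0 : 0 <= rnorm x * rnorm y by rewrite mulr_ge0 ?rnorm_ge0.
  set K := rnorm x * rnorm y in K0.
  have e1 : 0 < e / (2 * K + 1) by rewrite divr_gt0 //; lra.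
  have eE : e = e / (2 * K + 1) * (2 * K + 1) by rewrite divfK // gt_eqF //; lra.
  have [n1 /(_ (maxn n1 _) x (leq_maxl _ _)) h1] := hf _ e1.
  have [n2 h2] := hg _ e1; have {}h1 := h1 n2.
  have {}h2 := h2 _ y (leq_maxr n1 n2); set n := maxn n1 n2 in h1 h2.
  have -> : inner (f x) y - inner x (g y) =
      - inner (bop_fun (u n) x - f x) y + inner x (bop_fun (bop_star (u n)) y - g y).
    by rewrite dotBl dotBr bop_adjoint; ring.
  apply: le_trans (ler_normD _ _) _; rewrite normrN.
  apply: le_trans (lerD (inner_le_rnorm _ _) (inner_le_rnorm _ _)) _.
  rewrite -rmorphD lecR; have x0 := rnorm_ge0 x; have y0 := rnorm_ge0 y.
  have := ler_wpM2r y0 h1; have := ler_wpM2l x0 h2.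
  by rewrite /K in eE e1 *; set t := e / _ in eE e1 *; nra.
have fa : adjointable f.
  by exists g; split; [exact: fg | exact: bnd hf | exact: bnd hg].
exists (mk_bop fa); apply/cvgrPdist_le => e e0; have [n0 h] := hf e e0.
exists n0 => // n /= hn; rewrite sub0r normrN ger0_norm ?opnorm_ge0 //.
by apply: opnorm_le; [move=> x; exact: h | exact: ltW].
Qed.

HB.instance Definition _ := isCStarAlgebra.Build R bop
  opnorm_eq0 opnormD opnormZ opnormM bop_complete bop_starK bop_starD bop_starZ
  bop_starM opnorm_cstar.
End BopAlgebra.

(** * Reindexing and bases *)

Section Reindexing.
Variables (R : realType) (X : eqType).

(** A bijection between [D] and [E] carries a large finite part of [D] to a
    finite part of [E]; adding to it the indices of [u] outside [E], which
    contribute nothing, makes it large enough to be close to the limit. *)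
Lemma sum_cvg_reindex (D E : pred X) (phi psi : X -> X) (h : X -> R[i]) (l : R[i]) :
  (forall x, D x -> E (phi x)) -> {in D, cancel phi psi} ->
  (forall y, E y -> D (psi y)) -> {in E, cancel psi phi} ->
  (fun t => \sum_(y <- t | E y) h y : R[i]^o) @ finite_sums X --> (l : R[i]^o) ->
  (fun t => \sum_(x <- t | D x) h (phi x) : R[i]^o) @ finite_sums X --> (l : R[i]^o).
Proof.
move=> DE phiK ED psiK /cvgrPdist_lt hl; apply/cvgrPdist_lt => e e0.
have [u _ hu] := hl e e0.
apply: (finite_sums_near (u := [seq psi y | y <- u & E y])) => t ut sub_t.
pose t' := [seq phi x | x <- t & D x] ++ [seq y <- undup u | ~~ E y].
suff -> : \sum_(x <- t | D x) h (phi x) = \sum_(y <- t' | E y) h y.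
  apply: hu; split.
    rewrite cat_uniq map_inj_in_uniq ?filter_uniq ?undup_uniq //=; last first.
      move=> x y; rewrite !mem_filter => /andP[Dx _] /andP[Dy _] /(congr1 psi).
      by rewrite !phiK.
    rewrite andbT; apply/hasPn => y; rewrite mem_filter => /andP[Ey _].
    apply: contra Ey => /mapP [x]; rewrite mem_filter => /andP[Dx _] ->.
    exact: DE.
  move=> y yu; rewrite mem_cat !mem_filter mem_undup yu andbT.
  case Ey : (E y); rewrite ?orbT // orbF; apply/mapP; exists (psi y).
    by rewrite mem_filter ED // sub_t // map_f // mem_filter Ey.
  by rewrite psiK.
rewrite big_cat /= big_map big_filter_cond [X in _ + X]big1_seq ?addr0; last first.
  by move=> y /andP[Ey]; rewrite mem_filter Ey.
apply: eq_bigl => x; case Dx : (D x) => //=; exact/esym/DE.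
Qed.
End Reindexing.

Section L2Basis.
Variables (R : realType) (X : eqType).
Local Notation l2 := (l2 R X).

Definition l2_delta (x y : X) : R[i] := (y == x)%:R.

Lemma l2_delta_summable x : square_summable (l2_delta x).
Proof.
exists 1 => t ut; rewrite /sqsum /l2_delta.
have [xt|xt] := boolP (x \in t).
  rewrite (perm_big _ (perm_to_rem xt)) big_cons eqxx big1_seq; last first.
    move=> y /andP[_]; rewrite mem_rem_uniq // !inE => /andP[/negPf -> _].
    by rewrite -[0%:R]/(0 : R[i]^o) rnorm0 expr0n.
  rewrite Monoid.mulm1 -lecR rmorphXn [leLHS]/= rnormE normr1 expr1n //.
rewrite big1_seq // => y /andP[_ yt].
have /negPf -> : y != x by apply: contra xt => /eqP <-.
by rewrite -[0%:R]/(0 : R[i]^o) rnorm0 expr0n.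
Qed.

Definition l2_basis x : l2 := mk_l2 (l2_delta_summable x).

Lemma inner_l2_basis (f : l2) x : inner f (l2_basis x) = l2_fun f x.
Proof.
rewrite -[LHS]/(l2_inner f (l2_basis x)).
suff h : (fun t => dotsum t (l2_fun f) (l2_delta x) : R[i]^o) @ finite_sums X
    --> (l2_fun f x : R[i]^o) by exact: (l2_inner_unique h).
apply: (@cvg_near_cst _ R[i]^o).
apply: (finite_sums_near (u := [:: x])) => t ut /(_ x (mem_head _ _)) xt.
rewrite /dotsum (perm_big _ (perm_to_rem xt)) big_cons /l2_delta eqxx big1_seq.
  by rewrite Monoid.mulm1 rmorph1 mulr1.
move=> y /andP[_]; rewrite mem_rem_uniq // !inE => /andP[/negPf -> _].
by rewrite rmorph0 mulr0.
Qed.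

Lemma inner_l2_basis2 x y : inner (l2_basis x) (l2_basis y) = (x == y)%:R.
Proof. by rewrite inner_l2_basis /= /l2_delta eq_sym. Qed.

Lemma l2_fun_sum (I : Type) (r : seq I) (F : I -> l2) x :
  l2_fun (\sum_(i <- r) F i) x = \sum_(i <- r) l2_fun (F i) x.
Proof. by elim/big_rec2: _ => [|i a b _ <-]. Qed.

Lemma l2_basis_dense (f : l2) (e : R) : 0 < e ->
  exists t : seq X, rnorm (f - \sum_(x <- t) l2_fun f x *: l2_basis x) < e.
Proof.
move=> e0; have e2 : 0 < (e / 2) ^+ 2 by rewrite exprn_gt0 //; lra.
have sf := l2P f.
have [_ [t ut <-] ht] : exists2 y, [set sqsum t (l2_fun f) | t in [set t | uniq t]] y
    & total_sqsum (l2_fun f) - (e / 2) ^+ 2 < y.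
  apply: sup_adherent => //; split; first by exists (sqsum [::] (l2_fun f)), [::].
  by exists (total_sqsum (l2_fun f)) => _ [t ut <-]; exact: sqsum_le_total.
exists t; apply: (@le_lt_trans _ _ (e / 2)); last by lra.
apply: l2_rnorm_le => [|u uu]; first by lra.
set g := \sum_(x <- t) _.
have gE y : l2_fun g y = if y \in t then l2_fun f y else 0.
  rewrite l2_fun_sum; have [yt|yt] := boolP (y \in t).
    rewrite (perm_big _ (perm_to_rem yt)) big_cons big1_seq.
      by rewrite Monoid.mulm1 l2_funZ /= /l2_delta eqxx mulr1.
    move=> x /andP[_]; rewrite mem_rem_uniq // !inE eq_sym => /andP[/negPf xy _].
    by rewrite l2_funZ /= /l2_delta xy mulr0.
  rewrite big1_seq // => x /andP[_ xt]; rewrite l2_funZ /= /l2_delta.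
  by have /negPf -> : y != x; rewrite ?mulr0 //; apply: contra yt => /eqP ->.
have -> : sqsum u (l2_fun (f - g)) = sqsum [seq x <- u | x \notin t] (l2_fun f).
  rewrite /sqsum big_filter [RHS]big_mkcond; apply: eq_bigr => x _.
  rewrite l2_funD l2_funN gE; case: (x \in t) => /=; last by rewrite subr0.
  by rewrite subrr -[0]/(0 : R[i]^o) rnorm0 expr0n.
have : sqsum (t ++ [seq x <- u | x \notin t]) (l2_fun f) <= total_sqsum (l2_fun f).
  apply: sqsum_le_total => //; rewrite cat_uniq ut filter_uniq // andbT /=.
  by apply/hasPn => x; rewrite mem_filter => /andP[].
rewrite {1}/sqsum big_cat /= -!/(sqsum _ _); lra.
Qed.
End L2Basis.

(** * Representations from morphisms to bounded operators *)

Definition bop_linear_map (R : realType) (H : hilbertType R)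
    (nt : exists w : H, w != 0) (a : bop nt) : {linear H -> H} :=
  HB.pack (bop_fun a) (GRing.isLinear.Build _ _ _ _ (bop_fun a) (bop_linear a)).

Lemma rep_of_morphism (R : realType) (B : cstarAlgType R) (H : hilbertType R)
    (nt : exists w : H, w != 0) (f : {lrmorphism B -> bop nt}) :
  (forall a, f (star a) = star (f a)) ->
  exists pi : representation B H, forall a x, pi a x = bop_fun (f a) x.
Proof.
move=> fstar; unshelve eexists (@Representation R B H
  (fun a => bop_linear_map (f a)) _ _ _ _ _ _) => //.
- move=> a; exists (opnorm (f a))%:C => x /=.
  by rewrite -!rnormE -rmorphM lecR le_opnorm.
- by move=> a b x /=; rewrite rmorphD.
- by move=> c a x /=; rewrite linearZ.
- by move=> a b x /=; rewrite rmorphM.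
- by move=> x /=; rewrite rmorph1.
- by move=> a x y /=; rewrite fstar -bop_adjoint.
Qed.

(** * Branching systems *)

(** Points of [X] behave like one-sided sequences: [hd] reads the first letter,
    [tau] deletes it, and [ext i] prepends [i] where [A] allows it. The
    weighted composition operators attached to these maps satisfy the
    Cuntz-Krieger relations. *)
Section BranchingSystem.
Variables (R : realType) (N : nat) (A : 'M[bool]_N) (X : eqType).
Variables (hd : X -> 'I_N) (tau : X -> X) (ext : 'I_N -> X -> X).
Hypothesis hd_tau : forall x, A (hd x) (hd (tau x)).
Hypothesis extK : forall x, ext (hd x) (tau x) = x.
Hypothesis hd_ext : forall i y, A i (hd y) -> hd (ext i y) = i.
Hypothesis tau_ext : forall i y, A i (hd y) -> tau (ext i y) = y.
Variable zeta : R[i].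
Hypothesis zeta1 : `|zeta| = 1.
Local Notation l2 := (l2 R X).

Lemma zeta_conj : zeta * Num.conj zeta = 1.
Proof. by rewrite -normCK zeta1 expr1n. Qed.

Lemma rnorm_zetaM (z : R[i]) : rnorm (zeta * z : R[i]^o) = rnorm (z : R[i]^o).
Proof. by rewrite /rnorm normrM zeta1 mul1r. Qed.

Lemma rnorm_conj_zetaM (z : R[i]) :
  rnorm (Num.conj zeta * z : R[i]^o) = rnorm (z : R[i]^o).
Proof. by rewrite /rnorm normrM norm_conjC zeta1 mul1r. Qed.

(** This sends the basis vector [e_y] to [zeta e_(ext i y)] if [A i (hd y)], and
    to 0 otherwise. *)
Definition shift_fun i (f : X -> R[i]) x :=
  if hd x == i then zeta * f (tau x) else 0.

Definition coshift_fun i (f : X -> R[i]) y :=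
  if A i (hd y) then Num.conj zeta * f (ext i y) else 0.

(** [tau] is injective on the points with first letter [i], so that the sum is
    a rearrangement of part of the sum of [|f|^2]. *)
Lemma sqsum_shift i f t : uniq t ->
  exists2 t', uniq t' & sqsum t (shift_fun i f) = sqsum t' f.
Proof.
move=> ut; exists [seq tau x | x <- t & hd x == i].
  rewrite map_inj_in_uniq ?filter_uniq // => x y.
  rewrite !mem_filter => /andP[/eqP xi _] /andP[/eqP yi _] e.
  by rewrite -(extK x) -(extK y) e xi yi.
rewrite /sqsum big_map big_filter [RHS]big_mkcond; apply: eq_bigr => x _.
rewrite /shift_fun; case: (hd x == i); first by rewrite rnorm_zetaM.
by rewrite -[0]/(0 : R[i]^o) rnorm0 expr0n.
Qed.

Lemma sqsum_coshift i f t : uniq t ->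
  exists2 t', uniq t' & sqsum t (coshift_fun i f) = sqsum t' f.
Proof.
move=> ut; exists [seq ext i x | x <- t & A i (hd x)].
  rewrite map_inj_in_uniq ?filter_uniq // => x y.
  rewrite !mem_filter => /andP[xi _] /andP[yi _] e.
  by rewrite -(tau_ext xi) -(tau_ext yi) e.
rewrite /sqsum big_map big_filter [RHS]big_mkcond; apply: eq_bigr => x _.
rewrite /coshift_fun; case: (A i _); first by rewrite rnorm_conj_zetaM.
by rewrite -[0]/(0 : R[i]^o) rnorm0 expr0n.
Qed.

Lemma shift_summable i f : square_summable f -> square_summable (shift_fun i f).
Proof.
by move=> [M hM]; exists M => t /(sqsum_shift i f) [t' ut' ->]; exact: hM.
Qed.

Lemma coshift_summable i f :
  square_summable f -> square_summable (coshift_fun i f).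
Proof.
by move=> [M hM]; exists M => t /(sqsum_coshift i f) [t' ut' ->]; exact: hM.
Qed.

Definition shift_op i (f : l2) : l2 := mk_l2 (shift_summable i (l2P f)).
Definition coshift_op i (f : l2) : l2 := mk_l2 (coshift_summable i (l2P f)).

Lemma shift_bounded i : bounded_op (shift_op i).
Proof.
exists 1 => // f; rewrite mul1r; apply: l2_rnorm_le; first exact: rnorm_ge0.
by move=> t /(sqsum_shift i (l2_fun f)) [t' ut' ->]; exact: l2_rnorm_sqsum.
Qed.

Lemma coshift_bounded i : bounded_op (coshift_op i).
Proof.
exists 1 => // f; rewrite mul1r; apply: l2_rnorm_le; first exact: rnorm_ge0.
by move=> t /(sqsum_coshift i (l2_fun f)) [t' ut' ->]; exact: l2_rnorm_sqsum.
Qed.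

Lemma shift_adjoint i : adjoint_pair (shift_op i) (coshift_op i).
Proof.
move=> f g; rewrite -[LHS]/(l2_inner _ _) -[RHS]/(l2_inner _ _).
pose h y := zeta * l2_fun f y * Num.conj (l2_fun g (ext i y)).
have hE : (fun t => dotsum t (l2_fun f) (coshift_fun i (l2_fun g))) =
    (fun t => \sum_(y <- t | A i (hd y)) h y).
  apply/funext => t; rewrite /dotsum [RHS]big_mkcond; apply: eq_bigr => y _.
  rewrite /coshift_fun; case: (A i _); last by rewrite rmorph0 mulr0.
  by rewrite rmorphM /= conjCK mulrCA mulrA.
have hS t : dotsum t (shift_fun i (l2_fun f)) (l2_fun g) =
    \sum_(x <- t | hd x == i) h (tau x).
  rewrite /dotsum [RHS]big_mkcond; apply: eq_bigr => x _.
  rewrite /shift_fun /h; case: eqP => [<-|_]; last by rewrite mul0r.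
  by rewrite extK.
have := l2_inner_cvg f (coshift_op i g); rewrite [l2_fun (coshift_op i g)]/= hE => hl.
suff hr : (fun t => \sum_(x <- t | hd x == i) h (tau x) : R[i]^o) @ finite_sums X
    --> (l2_inner f (coshift_op i g) : R[i]^o) by exact: (l2_inner_unique hr).
apply: (@sum_cvg_reindex R X (fun x => hd x == i) (fun y => A i (hd y)) tau (ext i)) hl.
- by move=> x /eqP <-.
- by move=> x /eqP <-; rewrite extK.
- by move=> y /hd_ext ->.
- by move=> y /tau_ext.
Qed.

Lemma shift_adjointable i : adjointable (shift_op i).
Proof.
exists (coshift_op i); split.
- exact: shift_adjoint.
- exact: shift_bounded.
- exact: coshift_bounded.
Qed.

Variable x0 : X.

Lemma l2_nontrivial : exists w : l2, w != 0.
Proof.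
exists (l2_basis R x0); apply/eqP => e; have := inner_l2_basis2 R x0 x0.
by rewrite {1}e dot0l eqxx => /esym /eqP; rewrite oner_eq0.
Qed.
Local Notation bop := (bop l2_nontrivial).

Definition shift_bop i : bop := mk_bop _ (shift_adjointable i).

Lemma star_shift_bop i x : bop_fun (star (shift_bop i)) x = coshift_op i x.
Proof.
have -> : bop_fun (star (shift_bop i)) = coshift_op i; last by [].
apply: (@adjoint_pair_unique R l2 (shift_op i)); last exact: shift_adjoint.
by move=> f g; exact: (bop_adjoint (shift_bop i)).
Qed.

Lemma bop_fun_sum (I : Type) (r : seq I) (F : I -> bop) f :
  bop_fun (\sum_(i <- r) F i) f = \sum_(i <- r) bop_fun (F i) f.
Proof. by elim/big_rec2: _ => [|i a b _ <-]. Qed.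

Lemma shift_coshift i (f : l2) x :
  l2_fun (shift_op i (coshift_op i f)) x = (hd x == i)%:R * l2_fun f x.
Proof.
rewrite /= /shift_fun; case: eqP => [<-|_]; last by rewrite mul0r.
by rewrite /coshift_fun hd_tau extK mulrA zeta_conj.
Qed.

Lemma coshift_shift i (f : l2) y :
  l2_fun (coshift_op i (shift_op i f)) y = (A i (hd y))%:R * l2_fun f y.
Proof.
rewrite /= /coshift_fun; case: ifP => [Ai|_]; last by rewrite mul0r.
by rewrite /shift_fun hd_ext // eqxx tau_ext // mulrA [_ * zeta]mulrC zeta_conj.
Qed.

Lemma shift_ck_family : cuntz_krieger_family A shift_bop.
Proof.
split.
- move=> i; apply: bop_ext => f; apply: l2_ext => x.
  rewrite !bop_funM star_shift_bop [LHS]shift_coshift /= /shift_fun.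
  by case: eqP => _; rewrite ?mul1r ?mulr0.
- move=> i; apply: bop_ext => f; apply: l2_ext => x.
  rewrite bop_funM star_shift_bop [LHS]coshift_shift bop_fun_sum l2_fun_sum.
  transitivity (\sum_(j < N) (A i j)%:R * ((hd x == j)%:R * l2_fun f x)).
    rewrite (bigD1 (hd x)) //= eqxx mul1r big1 ?addr0 // => j.
    by rewrite eq_sym => /negPf ->; rewrite mul0r mulr0.
  apply: eq_bigr => j _.
  by rewrite bop_funZ l2_funZ bop_funM star_shift_bop [in RHS]shift_coshift.
- apply: bop_ext => f; apply: l2_ext => x; rewrite bop_fun_sum l2_fun_sum.
  rewrite (bigD1 (hd x)) // big1 ?Monoid.mulm1 => [|j /andP[_]].
    by rewrite bop_funM star_shift_bop [LHS]shift_coshift eqxx mul1r.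
  rewrite eq_sym => /negPf hj.
  by rewrite bop_funM star_shift_bop [LHS]shift_coshift hj mul0r.
Qed.

Lemma shift_basis x :
  shift_op (hd x) (l2_basis R (tau x)) = zeta *: l2_basis R x.
Proof.
apply: l2_ext => y; rewrite l2_funZ /= /shift_fun /l2_delta.
have [->|yx] := eqVneq y x; first by rewrite !eqxx.
case: eqP => [hyx|_]; last by rewrite mulr0.
case: eqP => // tyx; case/eqP: yx.
by rewrite -(extK y) -(extK x) hyx tyx.
Qed.

Lemma coshift_basis x :
  coshift_op (hd x) (l2_basis R x) = Num.conj zeta *: l2_basis R (tau x).
Proof.
apply: l2_ext => y; rewrite l2_funZ /= /coshift_fun /l2_delta.
have [->|yx] := eqVneq y (tau x); first by rewrite hd_tau extK eqxx.
case: ifP => [Ahy|_]; last by rewrite mulr0.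
case: eqP => // eyx; case/eqP: yx.
by rewrite -eyx tau_ext.
Qed.

Hypothesis tails : forall x, exists n m, iter n tau x = iter m tau x0.
Variables (B : cstarAlgType R) (s : 'I_N -> B).
Hypothesis B_univ : is_cuntz_krieger_algebra A s.

(** Each basis vector lies in the orbit of the cyclic vector [e_x0]: the tails
    of [x0] are reached by the [s_i^*], and a point that shares a tail with
    [x0] is reached from that tail by prepending letters. *)
Lemma branching_rep : exists pi : representation B l2,
  [/\ (forall x, pi (s (hd x)) (l2_basis R (tau x)) = zeta *: l2_basis R x) &
      cyclic_vector pi (l2_basis R x0)].
Proof.
have [f [fstar fs]] := ck_universal B_univ shift_ck_family.
have [pi hpi] := rep_of_morphism fstar.
have pi_shift x : pi (s (hd x)) (l2_basis R (tau x)) = zeta *: l2_basis R x.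
  by rewrite hpi fs; exact: shift_basis.
exists pi; split => //; apply: rnorm_dense.
pose D : set l2 := range (fun a => pi a (l2_basis R x0)).
have DM a h : D h -> D (pi a h) by move=> [b _ <-]; exists (a * b); rewrite ?repM.
have DZ c h : D h -> D (c *: h) by move=> [b _ <-]; exists (c *: b); rewrite ?repZ.
have D_tail m : D (l2_basis R (iter m tau x0)).
  elim: m => [|m IH]; first by exists 1; rewrite ?rep1.
  rewrite iterS; set x := iter m tau x0 in IH *.
  have -> : l2_basis R (tau x) = zeta *: pi (star (s (hd x))) (l2_basis R x).
    rewrite hpi fstar fs star_shift_bop coshift_basis scalerA zeta_conj.
    by rewrite scale1r.
  exact/DZ/DM.
have D_basis x : D (l2_basis R x).
  have [n [m e]] := tails x; have := D_tail m; rewrite -e {e}.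
  elim: n x => [//|n IH] x; rewrite iterSr => /IH h.
  have -> : l2_basis R x = Num.conj zeta *: pi (s (hd x)) (l2_basis R (tau x)).
    by rewrite pi_shift scalerA mulrC zeta_conj scale1r.
  exact/DZ/DM.
move=> h e e0; have [t ht] := l2_basis_dense h e0.
exists (\sum_(x <- t) l2_fun h x *: l2_basis R x) => //.
elim: t {ht} => [|x t [b _ hb]]; first by rewrite big_nil; exists 0; rewrite ?rep0.
have [a _ ha] := DZ (l2_fun h x) _ (D_basis x).
by exists (a + b); rewrite // repD ha hb big_cons.
Qed.
End BranchingSystem.

(** * The space of sequences with the tail of a given word *)

Section TailSpace.
Variables (N : nat) (A : 'M[bool]_N) (J : nat -> 'I_N) (K : zmodType) (kappa : K).
Hypothesis JA : infinite_word A J.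
Local Notation Y := ((nat -> 'I_N) * K)%type.
Implicit Types x y : Y.

(** A sequence is paired with a lag in [K], which records by how much it is
    displaced along [J]. Without it the tails of [J] could repeat earlier than
    the relations allow, for instance if [p = 0] and [J] is periodic. *)
Definition tail_shift x : Y := (fun n => x.1 n.+1, x.2 + kappa).
Definition tail_cons (i : 'I_N) x : Y :=
  (fun n => if n is m.+1 then x.1 m else i, x.2 - kappa).

Definition tail_start : Y := (J, 0).

Definition same_tail : pred Y := fun x =>
  `[< infinite_word A x.1 /\
      exists n m, iter n tail_shift x = iter m tail_shift tail_start >].

Definition tail_space := {x : Y | same_tail x}.

Lemma iter_tail_shift n x :
  iter n tail_shift x = (fun r => x.1 (n + r)%N, x.2 + kappa *+ n).
Proof.
elim: n => [|n IH]; first by rewrite addr0; case: x.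
rewrite iterS IH /tail_shift /= mulrSr addrA; congr (_, _).
by apply/funext => r; rewrite addnS.
Qed.

Lemma tail_consK i : cancel (tail_cons i) tail_shift.
Proof. by case=> y k; rewrite /tail_shift /= subrK. Qed.

Lemma tail_shiftK x : tail_cons (x.1 0%N) (tail_shift x) = x.
Proof.
case: x => y k; rewrite /tail_cons /tail_shift /= addrK; congr (_, _).
by apply/funext => -[].
Qed.

Lemma same_tail_shift x : same_tail x -> same_tail (tail_shift x).
Proof.
move=> /asboolP [xA [n [m e]]]; apply/asboolP; split; first by move=> r; exact: xA.
by exists n, m.+1; rewrite -iterSr !iterS e.
Qed.

Lemma same_tail_cons i x : A i (x.1 0%N) -> same_tail x -> same_tail (tail_cons i x).
Proof.
move=> Ai /asboolP [xA [n [m e]]]; apply/asboolP; split; first by case.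
by exists n.+1, m; rewrite iterSr tail_consK.
Qed.

Lemma same_tail_start : same_tail tail_start.
Proof. by apply/asboolP; split => //; exists 0%N, 0%N. Qed.

Implicit Types u : tail_space.

Definition tail_hd (x : tail_space) : 'I_N := (val x).1 0%N.
(* The default value [x] is never taken: shifting stays in the space. *)
Definition tail_tau (x : tail_space) : tail_space := insubd x (tail_shift (val x)).
(* The default value [x] is taken exactly when [i] may not precede [x]. *)
Definition tail_ext i (x : tail_space) : tail_space := insubd x (tail_cons i (val x)).
Definition tail_origin : tail_space := Sub tail_start same_tail_start.

Lemma val_tail_tau u : val (tail_tau u) = tail_shift (val u).
Proof. by rewrite val_insubd same_tail_shift //; exact: valP. Qed.

Lemma val_tail_ext i u : A i (tail_hd u) -> val (tail_ext i u) = tail_cons i (val u).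
Proof. by move=> Ai; rewrite val_insubd same_tail_cons //; exact: valP. Qed.

Lemma val_iter_tail_tau n u : val (iter n tail_tau u) = iter n tail_shift (val u).
Proof. by elim: n => [//|n IH]; rewrite !iterS val_tail_tau IH. Qed.

Lemma tail_hd_tau u : A (tail_hd u) (tail_hd (tail_tau u)).
Proof. by rewrite /tail_hd val_tail_tau; have /asboolP [uA _] := valP u; exact: uA. Qed.

Lemma tail_extK u : tail_ext (tail_hd u) (tail_tau u) = u.
Proof.
apply: val_inj; rewrite val_tail_ext ?tail_hd_tau // val_tail_tau.
exact: tail_shiftK.
Qed.

Lemma tail_hd_ext i u : A i (tail_hd u) -> tail_hd (tail_ext i u) = i.
Proof. by move=> Ai; rewrite /tail_hd val_tail_ext. Qed.

Lemma tail_tau_ext i u : A i (tail_hd u) -> tail_tau (tail_ext i u) = u.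
Proof. by move=> Ai; apply: val_inj; rewrite val_tail_tau val_tail_ext ?tail_consK. Qed.

Lemma tail_space_tails u :
  exists n m, iter n tail_tau u = iter m tail_tau tail_origin.
Proof.
have /asboolP [_ [n [m e]]] := valP u; exists n, m.
by apply: val_inj; rewrite !val_iter_tail_tau.
Qed.

Lemma tail_hd_iter n : tail_hd (iter n tail_tau tail_origin) = J n.
Proof. by rewrite /tail_hd val_iter_tail_tau iter_tail_shift /= addn0. Qed.

Lemma iter_tail_tau_eq p n m : (forall n, J (n + p)%N = J n) ->
  (forall n m, (kappa *+ n == kappa *+ m) = (n == m %[mod p])) ->
  (iter n tail_tau tail_origin == iter m tail_tau tail_origin) = (n == m %[mod p]).
Proof.
move=> Jp kp; rewrite -val_eqE !val_iter_tail_tau !iter_tail_shift /= !add0r.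
have J_mod k : J k = J (k %% p)%N.
  rewrite {1}(divn_eq k p); elim: (k %/ p)%N => [//|q IH].
  by rewrite mulSn -addnA addnC Jp.
rewrite xpair_eqE kp andbC; case: eqP => [e|//].
apply/eqP/funext => r.
by rewrite J_mod -modnDml e modnDml -J_mod.
Qed.
End TailSpace.

Section WordVectorsExist.
Variables (R : realType) (N : nat) (A : 'M[bool]_N).
Variables (B : cstarAlgType R) (s : 'I_N -> B).
Hypothesis B_univ : is_cuntz_krieger_algebra A s.
Variables (J : nat -> 'I_N) (p : nat) (zeta : R[i]).
Hypothesis JA : infinite_word A J.
Hypothesis Jp : forall n, J (n + p)%N = J n.
Hypothesis zeta1 : `|zeta| = 1.

Lemma word_vectors_of_lag (K : zmodType) (kappa : K) :
  (forall n m, (kappa *+ n == kappa *+ m) = (n == m %[mod p])) ->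
  exists (H : hilbertType R) (pi : representation B H) v,
    word_vectors s pi J p zeta v.
Proof.
move=> kp; have [pi [pi_s pi_cyc]] := branching_rep (@tail_hd_tau _ A J K kappa)
  (@tail_extK _ A J K kappa) (@tail_hd_ext _ A J K kappa) (@tail_tau_ext _ A J K kappa)
  zeta1 (@tail_space_tails _ A J K kappa JA) B_univ.
pose x n := iter n (@tail_tau _ A J K kappa) (tail_origin kappa JA).
exists _, pi, (fun n => l2_basis R (x n)); split => //.
- by move=> n; rewrite -pi_s /x tail_hd_iter.
- move=> n m; rewrite inner_l2_basis2; congr (nat_of_bool _)%:R.
  exact: iter_tail_tau_eq.
Qed.

(** Lags are counted modulo [p]: in the integers for [p = 0]. *)
Lemma word_vectors_exist : exists (H : hilbertType R) (pi : representation B H) v,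
  word_vectors s pi J p zeta v.
Proof.
case: p word_vectors_of_lag => [|q] lag.
  apply: (lag int 1) => n m; rewrite !modn0.
  exact: eqr_nat.
apply: (lag 'I_q.+1 (inZp 1)) => n m.
by rewrite !Zp_mulrn -val_eqE /= !modnMml !mul1n.
Qed.

End WordVectorsExist.

(** * The relations P(J;z) and P(J) in terms of word vectors *)

Section Conversions.
Variables (R : realType) (N : nat) (A : 'M[bool]_N).
Variables (B : cstarAlgType R) (s : 'I_N -> B).
Hypothesis ckf : cuntz_krieger_family A s.

Section OneRep.
Variables (H : hilbertType R) (pi : representation B H).

Lemma cyclic_vectorZ (c : R[i]) (x : H) :
  c != 0 -> cyclic_vector pi x -> cyclic_vector pi (c *: x).
Proof.
move=> c0; rewrite /cyclic_vector => xc; congr dense: xc.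
apply/seteqP; split=> _ [a _ <-].
  by exists (c^-1 *: a) => //; rewrite repZ linearZ scalerA mulVf // scale1r.
by exists (c *: a) => //; rewrite repZ linearZ.
Qed.

Lemma unit_norm_inner (x : H) : `|x| = 1 <-> inner x x = 1.
Proof.
rewrite -inner_norm; split=> [->|/eqP]; first by rewrite expr1n.
by rewrite sqrp_eq1 // => /eqP.
Qed.

Lemma unit_vectors_eq (x y : H) :
  inner x x = 1 -> inner y y = 1 -> inner x y = 1 -> x = y.
Proof.
move=> xx yy xy; apply/subr0_eq/eqP; rewrite -(dnorm_eq0 (@inner R H)).
by rewrite dotBl !dotBr xx yy xy (dotC _ y) xy rmorph1 !subrr.
Qed.

End OneRep.

Section FiniteWord.
Variables (J : seq 'I_N) (zeta : R[i]).
Hypothesis zeta1 : `|zeta| = 1.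
Hypothesis JA : cyclic_word A J.
Local Notation p := (size J).

Lemma cyclic_word_size : (0 < p)%N.
Proof. by case: J JA. Qed.

(** The periodic sequence repeating [J]; reading it off a tuple avoids a default
    letter. *)
Definition cyclic_letter (n : nat) : 'I_N :=
  tnth (in_tuple J) (Ordinal (ltn_pmod n cyclic_word_size)).

Lemma cyclic_letterE j0 n : cyclic_letter n = nth j0 J (n %% p)%N.
Proof. by rewrite /cyclic_letter (tnth_nth j0). Qed.

Lemma cyclic_letter_mod n m : n = m %[mod p] -> cyclic_letter n = cyclic_letter m.
Proof. by move=> nm; congr (tnth _ _); exact: val_inj. Qed.

Lemma cyclic_letterP n : cyclic_letter (n + p)%N = cyclic_letter n.
Proof. by apply: cyclic_letter_mod; rewrite modnDr. Qed.

Lemma modn_succ n : (n.+1 %% p)%N = if ((n %% p).+1 < p)%N then (n %% p).+1 else 0%N.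
Proof.
rewrite -addn1 -modnDml addn1; case: ltnP => [h|h]; first by rewrite modn_small.
have -> : (n %% p).+1 = p by apply/eqP; rewrite eqn_leq h andbT ltn_pmod ?cyclic_word_size.
exact: modnn.
Qed.

Lemma cyclic_letter_infinite_word : infinite_word A cyclic_letter.
Proof.
move=> n; set j0 := cyclic_letter 0.
rewrite (cyclic_letterE j0 n) (cyclic_letterE j0 n.+1) modn_succ.
have : (n %% p < p)%N by rewrite ltn_pmod ?cyclic_word_size.
case/andP: JA => _; case: J => [//|j K] /=.
move/(pathP j0); rewrite size_rcons => h iK; have := h _ iK.
move: iK; set i := (n %% _)%N; rewrite -rcons_cons !nth_rcons /= !ltnS => iK.
by rewrite iK; case: ltngtP iK.
Qed.

Local Notation word_tail l := (\prod_(j <- drop l J) s j).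

Lemma word_tail_step H (pi : representation B H) l (x : H) : (l < p)%N ->
  pi (word_tail l) x = pi (s (cyclic_letter l)) (pi (word_tail l.+1) x).
Proof.
move=> lp; set j0 := cyclic_letter 0; rewrite (drop_nth j0 lp) big_cons repM.
by rewrite (cyclic_letterE j0) modn_small.
Qed.

Lemma word_tail_size H (pi : representation B H) (x : H) : pi (word_tail p) x = x.
Proof. by rewrite drop_size big_nil rep1. Qed.

Lemma zeta_neq0 : zeta != 0.
Proof. by rewrite -normr_eq0 zeta1 oner_eq0. Qed.

Lemma zetaX_conj l : zeta ^+ l * Num.conj (zeta ^+ l) = 1.
Proof. by rewrite -normCK normrX zeta1 !expr1n. Qed.

(** The powers of [zeta] compensate the factor that each letter contributes;
    after [p] letters they account for the eigenvalue of the loop. *)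
Lemma is_Pz_word_vectors (H : hilbertType R) (pi : representation B H) :
  is_Pz s J (zeta ^+ p) pi -> exists v, word_vectors s pi cyclic_letter p zeta v.
Proof.
move=> [Om [Om1 Omc OmJ OmO]].
exists (fun n => zeta ^+ (n %% p) *: pi (word_tail (n %% p)) Om); split.
- move=> n; rewrite modn_succ; set l := (n %% p)%N.
  have lp : (l < p)%N by rewrite ltn_pmod ?cyclic_word_size.
  have -> : cyclic_letter n = cyclic_letter l.
    by apply: cyclic_letter_mod; rewrite modn_mod.
  rewrite scalerA -exprS linearZ /= (word_tail_step _ _ lp).
  case: ltnP => lp' //.
  have pE : l.+1 = p by apply/eqP; rewrite eqn_leq lp.
  by rewrite expr0 scale1r drop0 OmJ pE word_tail_size linearZ.
- move=> n m; have ltp k : (k %% p < p)%N by rewrite ltn_pmod ?cyclic_word_size.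
  have /= := OmO (Ordinal (ltp n)) (Ordinal (ltp m)).
  rewrite -val_eqE /= dotZl dotZr => ->.
  by case: eqP => [->|_]; rewrite ?mulr0 // mulr1 zetaX_conj.
- rewrite mod0n expr0 scale1r drop0 OmJ; apply: cyclic_vectorZ => //.
  by rewrite expf_neq0 ?zeta_neq0.
Qed.

Lemma word_vectors_is_Pz (H : hilbertType R) (pi : representation B H) v :
  word_vectors s pi cyclic_letter p zeta v -> is_Pz s J (zeta ^+ p) pi.
Proof.
move=> [vs vo vc].
have vp : v p = v 0%N by apply: unit_vectors_eq; rewrite vo ?modnn ?mod0n ?eqxx.
have vE l : (l <= p)%N -> pi (word_tail l) (v 0%N) = zeta ^+ (p - l) *: v l.
  move=> lp; rewrite -(subKn lp); elim: (p - l)%N (leq_subr l p) => [_|k IH kp].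
    by rewrite subn0 subnn expr0 scale1r word_tail_size.
  have pk : (p - k.+1 < p)%N by rewrite ltn_subrL cyclic_word_size.
  rewrite word_tail_step // -subSn // subSS IH 1?ltnW // linearZ /=.
  rewrite !subKn // 1?ltnW // -[in v (p - k)%N](subnSK kp) vs scalerA -exprSr //.
exists (v 0%N); split => //.
- by apply/unit_norm_inner; rewrite vo eqxx.
- by have := vE 0%N (leq0n _); rewrite drop0 subn0.
- move=> k l; rewrite !vE 1?ltnW // dotZl dotZr vo !modn_small //.
  rewrite -val_eqE; case: eqP => [->|_]; last by rewrite !mulr0.
  by rewrite mulr1 zetaX_conj.
Qed.
End FiniteWord.

Section InfiniteWord.
Variable J : nat -> 'I_N.
Hypothesis JA : infinite_word A J.

Local Notation reading n := (\prod_(j <- rev (mkseq J n)) star (s j)).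

Lemma reading_step H (pi : representation B H) n (x : H) :
  pi (reading n.+1) x = pi (star (s (J n))) (pi (reading n) x).
Proof. by rewrite mkseqS rev_rcons big_cons repM. Qed.

Lemma reading0 H (pi : representation B H) (x : H) : pi (reading 0) x = x.
Proof. by rewrite big_nil rep1. Qed.

Lemma ck_rep_star_partial H (pi : representation B H) i (x : H) :
  pi (star (s i)) (pi (s i) (pi (star (s i)) x)) = pi (star (s i)) x.
Proof.
have := congr1 star (ck_partial_isometry ckf i).
by rewrite !starM starK mulrA => e; rewrite -!repM ?mulrA e.
Qed.

(** The hypotheses say that [<s_i s_i^* x, x> = 1] for a unit vector [x], which
    is the case of equality in the Cauchy-Schwarz inequality. *)
Lemma ck_rep_range H (pi : representation B H) i (x : H) :
  inner x x = 1 -> inner (pi (star (s i)) x) (pi (star (s i)) x) = 1 ->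
  pi (s i) (pi (star (s i)) x) = x.
Proof.
move=> xx yy; apply: unit_vectors_eq => //; last by rewrite rep_star.
by rewrite rep_star ck_rep_star_partial.
Qed.

(** The orthonormal family starts with [v 1]. Since [v 0] and [v 1] are both
    unit vectors, [v 0 = s_j v 1] for the first letter [j], and orthogonality
    of [v 0] to the others is inherited from that of [v 1]. *)
Lemma is_P_infinite_word_vectors (H : hilbertType R) (pi : representation B H) :
  is_P_infinite s J pi -> exists v, word_vectors s pi J 0 1 v.
Proof.
move=> [Om [/unit_norm_inner Om1 Omc OmO]].
pose v n := pi (reading n) Om; have v0 : v 0%N = Om by exact: reading0.
have vS n : v n.+1 = pi (star (s (J n))) (v n) by exact: reading_step.
have vO n m : inner (v n.+1) (v m.+1) = (n == m)%:R by exact: OmO.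
have v1 n : inner (v n) (v n) = 1 by case: n => [|n]; rewrite ?v0 // vO eqxx.
have vR n : pi (s (J n)) (v n.+1) = v n by rewrite vS ck_rep_range -?vS.
have v0S m : inner (v 0%N) (v m.+1) = 0.
  rewrite -(vR 0%N) rep_star -(vR m.+1).
  have [e|ne] := eqVneq (J 0%N) (J m.+1); last by rewrite (ck_rep_orth ckf) // dot0r.
  by rewrite e vR -vS vO.
exists v; split; last by rewrite v0.
- by move=> n; rewrite scale1r.
- move=> n m; rewrite !modn0; case: n m => [|n] [|m] //.
  + by rewrite dotC v0S rmorph0.
  + exact: vO.
Qed.

Lemma word_vectors_is_P_infinite (H : hilbertType R) (pi : representation B H) v :
  word_vectors s pi J 0 1 v -> is_P_infinite s J pi.
Proof.
move=> [vs vo vc].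
have vE n : pi (reading n) (v 0%N) = v n.
  elim: n => [|n IH]; first exact: reading0.
  rewrite reading_step IH -[v n]/(path_vector s pi v ([::], n)).
  rewrite (path_vector_star ckf JA (oner_neq0 _) vs) /path_coef /path_tail /=.
  by rewrite eqxx invr1 mulr1 scale1r.
exists (v 0%N); split => //.
- by apply/unit_norm_inner; rewrite vo eqxx.
- by move=> n m; rewrite !vE vo !modn0.
Qed.
End InfiniteWord.
End Conversions.

(** * The theorem *)

Lemma exists_unique_of_word_vectors (R : realType) (N : nat) (A : 'M[bool]_N)
    (B : cstarAlgType R) (s : 'I_N -> B) (J : nat -> 'I_N) (p : nat) (zeta : R[i])
    (P : forall H : hilbertType R, representation B H -> Prop) :
  is_cuntz_krieger_algebra A s -> infinite_word A J ->
  (forall n, J (n + p)%N = J n) -> `|zeta| = 1 ->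
  (forall H (pi : representation B H), P H pi ->
     exists v, word_vectors s pi J p zeta v) ->
  (forall H (pi : representation B H) v, word_vectors s pi J p zeta v -> P H pi) ->
  exists_unique_rep P.
Proof.
move=> Buniv JA Jp z1 Pv vP; split.
  have [H [pi [v hv]]] := word_vectors_exist Buniv JA Jp z1.
  by exists H, pi; exact: vP hv.
move=> H1 H2 pi1 pi2 /Pv [v1 hv1] /Pv [v2 hv2].
have gen (S : set B) := @ck_generated _ _ _ _ _ Buniv S.
exact: (word_vectors_unique (ck_family Buniv) gen JA (zeta_neq0 z1) hv1 hv2).
Qed.

Theorem proposition3p5 (R : realType) (N : nat) (A : 'M[bool]_N)
    (OA : cstarAlgType R) (s : 'I_N -> OA) :
  (2 <= N)%N ->
  no_zero_row_col A ->
  is_cuntz_krieger_algebra A s ->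
  (forall J : (seq 'I_N + (nat -> 'I_N))%type, sharp_word A J ->
     exists_unique_rep (fun H (pi : representation OA H) => is_P s J pi)) /\
  (forall (J : seq 'I_N) (z : R[i]), cyclic_word A J -> `|z| = 1 ->
     exists_unique_rep (fun H (pi : representation OA H) => is_Pz s J z pi)).
Proof.
move=> _ _ OAuniv; have ckf := ck_family OAuniv.
have Pz (J : seq 'I_N) (z : R[i]) : cyclic_word A J -> `|z| = 1 ->
    exists_unique_rep (fun H (pi : representation OA H) => is_Pz s J z pi).
  move=> JA z1; have p0 := cyclic_word_size JA.
  have zE : ((size J).-root z) ^+ size J = z by rewrite rootCK.
  have zeta1 : `|(size J).-root z| = 1.
    by apply/eqP; rewrite -(pexpr_eq1 p0) // -normrX zE z1.
  rewrite -zE; apply: (exists_unique_of_word_vectors OAuniv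
    (cyclic_letter_infinite_word JA) (cyclic_letterP JA) zeta1) => H pi.
  - exact: is_Pz_word_vectors.
  - by move=> v; exact: word_vectors_is_Pz.
split=> // -[J|J] JA; first exact: Pz JA (normr1 _).
apply: (exists_unique_of_word_vectors OAuniv (p := 0) JA _ (normr1 _)) => [n|H pi|H pi v].
- by rewrite addn0.
- exact: (is_P_infinite_word_vectors ckf).
- exact: (word_vectors_is_P_infinite ckf JA).
Qed.
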